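(* Let $\lambda>0$ be arbitrary. For each $a>0$ there exists a u.l.m. point process supported on $a\mathbb{Z}$ that mimics the Poisson process of intensity $\lambda$ at the bandwidth $[-\frac{1}{2a},\frac{1}{2a}]$.
   Context: A configuration in $\mathbb{R}$ is a locally finite countable (possibly finite or empty) family $u=(u_j)_j$ of real numbers, repetitions allowed and counted with multiplicity (the labelling is irrelevant). For $V\subset\mathbb{R}$ put $\#_V(u)=\#\{j: u_j\in V\}$. A point process on $\mathbb{R}$ is a random configuration, measurable with respect to the $\sigma$-algebra generated by the sets $\{u:\#_V(u)=m\}$ with $V$ a bounded Borel set and $m\ge 0$ an integer. It is supported on $a\mathbb{Z}=\{aj: j\in\mathbb{Z}\}$ if all its points lie in $a\mathbb{Z}$. A point process is u.l.m. (has uniform local moments) if for each $n\ge1$ there is $C_n<\infty$ with $\mathbb{E}[(\#_{[L,L+1]}(u))^n]\le C_n$ for all $L\in\mathbb{R}$. The Poisson process of intensity $\lambda>0$ is the unique point process $w$ on $\mathbb{R}$ such that $\mathbb{E}\sum_{j_1,\dots,j_n\ \text{distinct}}\phi(w_{j_1},\dots,w_{j_n})=\int_{\mathbb{R}^n}\phi(x_1,\dots,x_n)\,\lambda^n\,dx_1\cdots dx_n$ for all $n\ge1$ and $\phi\in C_c(\mathbb{R}^n)$; it is u.l.m. Fourier transform: $\hat\eta(\xi)=\int_{\mathbb{R}^n}\eta(x)e^{-2\pi i x\cdot\xi}\,dx$. $\mathcal{S}(\mathbb{R}^n)$ is the Schwartz class. For u.l.m. point processes $u,v$ on $\mathbb{R}$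 and $B>0$, $v$ mimics $u$ at the bandwidth $[-B,B]$ if for each $n\ge1$ and all $\eta\in\mathcal{S}(\mathbb{R}^n)$ with $\hat\eta$ supported in $[-B,B]^n$, $\mathbb{E}\sum_{j_1,\dots,j_n\ \text{distinct}}\eta(u_{j_1},\dots,u_{j_n})=\mathbb{E}\sum_{j_1,\dots,j_n\ \text{distinct}}\eta(v_{j_1},\dots,v_{j_n})$. *)

(* Defs.v *)
From HB Require Import structures.
From mathcomp Require Import all_boot all_order all_algebra.
From mathcomp Require Import complex.
From mathcomp Require Import all_classical all_reals all_analysis.

Set Implicit Arguments.
Unset Strict Implicit.
Unset Printing Implicit Defensive.

Import Order.TTheory GRing.Theory Num.Theory.
Import numFieldNormedType.Exports.

Local Open Scope classical_set_scope.
Local Open Scope ring_scope.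

(** * Lebesgue measure on R^n

   The library has no Lebesgue measure on R^n for n > 1. The n-th power of a
   sigma-finite measure is built on n-tuples by induction on n, the product
   measure being carried to tuples by the isomorphism [(x, t) |-> x :: t]. *)

Section power_measure.
Context d (T : measurableType d) {R : realType}.

Definition cons_pair n (p : T * n.-tuple T) : n.+1.-tuple T :=
  [tuple of p.1 :: p.2].

Lemma measurable_cons_pair n : measurable_fun setT (@cons_pair n).
Proof. by apply: measurable_cons; [exact: measurable_fst|exact: measurable_snd]. Qed.

HB.instance Definition _ n := isMeasurableFun.Build _ _ _ _
  (@cons_pair n) (@measurable_cons_pair n).

Section step.
Variables (n : nat) (m : {sigma_finite_measure set T -> \bar R}).
Variable (mu : {sigma_finite_measure set (n.-tuple T) -> \bar R}).

Definition cons_measure : set (n.+1.-tuple T) -> \bar R :=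
  pushforward (m \x mu)%E (@cons_pair n).

Let cons_measure0 : cons_measure set0 = 0%E.
Proof. exact: measure0. Qed.

Let cons_measure_ge0 A : (0 <= cons_measure A)%E.
Proof. exact: measure_ge0. Qed.

Let cons_measure_semi_sigma_additive : semi_sigma_additive cons_measure.
Proof. exact: measure_semi_sigma_additive. Qed.

HB.instance Definition _ := isMeasure.Build _ _ _ cons_measure
  cons_measure0 cons_measure_ge0 cons_measure_semi_sigma_additive.

Lemma cons_measure_sigma_finite : sigma_finite setT cons_measure.
Proof.
have /sigma_finiteP[F [FT ndF Foo]] := sigma_finiteT m.
have /sigma_finiteP[G [GT ndG Goo]] := sigma_finiteT mu.
pose g (t : n.+1.-tuple T) : T * n.-tuple T := (thead t, [tuple of behead t]).
have mg : measurable_fun setT g.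
  by apply: measurable_fun_pair; [exact: measurable_tnth|exact: measurable_behead].
have gK : cancel (@cons_pair n) g.
  by move=> [x t]; rewrite /g /cons_pair theadE; congr pair; exact: val_inj.
exists (fun k => g @^-1` (F k `*` G k)).
  rewrite -preimage_bigcup (_ : \bigcup_k _ = setT) ?preimage_setT//.
  apply/seteqP; split => // -[x y] _.
  have [i _ Fx] : (\bigcup_i F i) x by rewrite -FT.
  have [k _ Gy] : (\bigcup_i G i) y by rewrite -GT.
  exists (maxn i k) => //; split => /=.
    by move: x Fx; exact/subsetPset/ndF/leq_maxl.
  by move: y Gy; exact/subsetPset/ndG/leq_maxr.
move=> k; have [mF Fk] := Foo k; have [mG Gk] := Goo k; split.
  by rewrite -[X in measurable X]setTI; apply: mg => //; exact: measurableX.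
rewrite /cons_measure /pushforward (_ : _ @^-1` _ = F k `*` G k).
  by rewrite product_measure1E// lte_mul_pinfty// ge0_fin_numE.
by rewrite -comp_preimage (_ : g \o _ = id) ?preimage_id//; exact/funext.
Qed.

HB.instance Definition _ := Measure_isSigmaFinite.Build _ _ _ cons_measure
  cons_measure_sigma_finite.

End step.

Fixpoint power_measure (m : {sigma_finite_measure set T -> \bar R}) n :
    {sigma_finite_measure set (n.-tuple T) -> \bar R} :=
  match n with
  | 0 => dirac ([tuple] : 0.-tuple T)
  | k.+1 => cons_measure m (power_measure m k)
  end.

End power_measure.

Definition lebesgue_tuple {R : realType} n :
    {sigma_finite_measure set (n.-tuple (measurableTypeR R)) -> \bar R} :=
  power_measure (@lebesgue_measure R) n.

(** * Functions on R^n

   R^n is ['rV[R]_n]. Limits, derivatives and integrals of complex-valued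
   functions are taken on real and imaginary parts. *)

Section functions.
Context {R : realType}.
Implicit Type n : nat.

Definition rV_of_tuple n (t : n.-tuple (measurableTypeR R)) : 'rV[R]_n :=
  \row_i tnth t i.

Definition integral_Rn n (f : 'rV[R]_n -> R) : R :=
  \int[lebesgue_tuple n]_t f (rV_of_tuple t).

Definition cintegral_Rn n (f : 'rV[R]_n -> R[i]) : R[i] :=
  (integral_Rn (fun x => complex.Re (f x)) +i*
   integral_Rn (fun x => complex.Im (f x)))%C.

Definition dotv n (x y : 'rV[R]_n) : R := \sum_i x ord0 i * y ord0 i.

Definition cexpi (t : R) : R[i] := (cos t +i* sin t)%C.

Definition fourier n (f : 'rV[R]_n -> R[i]) (xi : 'rV[R]_n) : R[i] :=
  cintegral_Rn (fun x => f x * cexpi (- (2 * pi * dotv x xi))).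

Definition support_Rn n (f : 'rV[R]_n -> R[i]) : set 'rV[R]_n :=
  closure [set x | f x != 0].

(* The partial derivative of f along the sequence s of coordinates. *)
Definition partials n (s : seq 'I_n) (f : 'rV[R]_n -> R) : 'rV[R]_n -> R :=
  foldr (fun i g x => 'D_(delta_mx ord0 i) g x) f s.

Definition smooth n (f : 'rV[R]_n -> R) :=
  forall s : seq 'I_n, continuous (partials s f) /\
    forall (i : 'I_n) (x : 'rV[R]_n), derivable (partials s f) x (delta_mx ord0 i).

Definition schwartz_real n (f : 'rV[R]_n -> R) :=
  smooth f /\
  forall (al : 'I_n -> nat) (s : seq 'I_n), exists C : R,
    forall x : 'rV[R]_n,
      `|(\prod_i x ord0 i ^+ al i) * partials s f x| <= C.

Definition schwartz n (f : 'rV[R]_n -> R[i]) :=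
  schwartz_real (fun x => complex.Re (f x)) /\
  schwartz_real (fun x => complex.Im (f x)).

Definition cont_compact_support n (f : 'rV[R]_n -> R[i]) :=
  [/\ continuous (fun x => complex.Re (f x)),
      continuous (fun x => complex.Im (f x)) &
      compact (support_Rn f)].

Definition cube n (B : R) : set 'rV[R]_n :=
  [set x | forall i, - B <= x ord0 i <= B].

End functions.

(** * Configurations and point processes *)

(* The family [(point j)_(j in labels)]; its labels range over an arbitrary set
   of natural numbers, so finite and empty families are included. *)
Record configuration (R : realType) := Configuration {
  labels : set nat ;
  point : nat -> R ;
  locally_finite : forall V : set R, bounded_set V ->
    finite_set [set j | labels j /\ V (point j)] }.

Section configurations.
Context {R : realType}.

Lemma empty_locally_finite (V : set R) : bounded_set V ->
  finite_set [set j | (set0 : set nat) j /\ V ((fun=> 0) j)].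
Proof.
by move=> _; rewrite (_ : mkset _ = set0)//; apply/seteqP; split => // j [].
Qed.

Definition empty_configuration : configuration R :=
  Configuration empty_locally_finite.

HB.instance Definition _ := gen_eqMixin (configuration R).
HB.instance Definition _ := gen_choiceMixin (configuration R).
HB.instance Definition _ := isPointed.Build (configuration R) empty_configuration.

Definition npoints (V : set R) (u : configuration R) : \bar R :=
  counting [set j | labels u j /\ V (point u j)].

Definition npoints_events : set (set (configuration R)) :=
  [set A | exists (V : set R) (m : nat),
    [/\ measurable (V : set (measurableTypeR R)), bounded_set V &
        A = [set u | npoints V u = m%:R%:E]]].

Definition distinct_tuples n (u : configuration R) : set {ffun 'I_n -> nat} :=
  [set j : {ffun 'I_n -> nat} | injective j /\ forall i, labels u (j i)].

(* The sum of f over all tuples of points with distinct labels, as the difference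
   of the sums of its positive and negative parts; it is meaningful when these
   are not both infinite. *)
Definition distinct_sum n (f : 'rV[R]_n -> R) (u : configuration R) : \bar R :=
  (\esum_(j in @distinct_tuples n u)
      (Num.max (f (\row_i point u (j i))) 0)%:E -
   \esum_(j in @distinct_tuples n u)
      (Num.max (- f (\row_i point u (j i))) 0)%:E)%E.

End configurations.

Record point_process (R : realType) := PointProcess {
  pp_display : measure_display ;
  pp_space : measurableType pp_display ;
  pp_prob : probability pp_space R ;
  pp_map :> pp_space -> configuration R ;
  pp_measurable : measurable_fun setT
    (pp_map : pp_space -> g_sigma_algebraType (@npoints_events R)) }.

Section point_processes.
Context {R : realType}.
Implicit Types u v w : point_process R.

Definition supported_on (S : set R) u :=
  forall (o : pp_space u) (j : nat), labels (u o) j -> S (point (u o) j).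

Definition lattice (a : R) : set R := [set a * k%:~R | k in [set: int]].

Definition ulm u := forall n : nat, (0 < n)%N -> exists C : R, forall L : R,
  (\int[pp_prob u]_o (npoints `[L, (L + 1)%R] (u o)) ^+ n <= C%:E)%E.

(* Real and imaginary parts of the expected sum of f over tuples of points with
   distinct labels. They are kept in \bar R, so that a divergent expectation
   cannot be mistaken for a finite one. *)
Definition correlation u n (f : 'rV[R]_n -> R[i]) : \bar R * \bar R :=
  ((\int[pp_prob u]_o distinct_sum (fun x => complex.Re (f x)) (u o))%E,
   (\int[pp_prob u]_o distinct_sum (fun x => complex.Im (f x)) (u o))%E).

Definition is_poisson (lambda : R) w :=
  forall (n : nat) (phi : 'rV[R]_n -> R[i]), (0 < n)%N ->
    cont_compact_support phi ->
    let I := cintegral_Rn (fun x => phi x * (lambda ^+ n)%:C%C) in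
    correlation w phi = ((complex.Re I)%:E, (complex.Im I)%:E).

(* v mimics u at the bandwidth [-B, B]. *)
Definition mimics (B : R) v u :=
  [/\ ulm u, ulm v &
      forall (n : nat) (eta : 'rV[R]_n -> R[i]), (0 < n)%N ->
        schwartz eta -> support_Rn (fourier eta) `<=` cube B ->
        correlation u eta = correlation v eta].

End point_processes.

(* Main.v *)
(** Round every point of a Poisson process [w] to the nearest point of [aZ].
   The [n]-point correlation measure of [w] is [lambda ^ n] times the Lebesgue
   measure, so that of the rounded process is [(lambda * a) ^ n] times the
   counting measure on the lattice [(aZ)^n], and mimicry is the Poisson
   summation formula: [a ^ n] times the sum of [eta] over [(aZ)^n] equals
   [\int eta], because the Fourier transform of [eta] vanishes at the nonzero
   points of the dual lattice.

   The summation formula is obtained by integrating [eta] against a product [P]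
   of Fejer kernels of period [a]. Expanding [P] in exponentials gives
   [\int eta P = \int eta]. Since [P] has the same integral as [1] over each
   cell of the lattice, [\int (eta o round) P = \int (eta o round)]. As [P]
   concentrates on the lattice, the two left-hand sides have the same limit.

   On the probabilistic side, the correlation identities, assumed for
   continuous compactly supported functions, extend to Borel functions by
   uniqueness of measures once the number of tuples of points with distinct
   labels in a box is known to be measurable; this follows from the counts of
   single sets by inclusion-exclusion on the first label. *)

Require Import Defs.
From HB Require Import structures.
From mathcomp Require Import all_boot all_order all_algebra.
From mathcomp Require Import finmap complex.
From mathcomp Require Import ring lra.
From mathcomp Require Import all_classical all_reals all_analysis measurable_realfun.
Import Order.TTheory GRing.Theory Num.Theory.
Import numFieldNormedType.Exports.
Local Open Scope classical_set_scope.
Local Open Scope ring_scope.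
Set Implicit Arguments.
Unset Strict Implicit.
Unset Printing Implicit Defensive.

(** * Integration on tuples *)

(** Concentration is measured by [sin (pi * x / a) ^+ 2], which vanishes exactly on the lattice. A
    one-variable kernel times this square is at most [N.+1%:R^-1], while for any [e > 0] the
    distance from [x] to its rounding is at most [e + M * sin (pi * x / a) ^+ 2], with [M] depending
    on [e]. A Lipschitz bound on [eta] turns the rounding error into a sum over coordinates, and [N]
    is chosen after [M].

    The errors must be integrable uniformly in [N], although [P] is not bounded uniformly in [N].
    They are dominated by a function constant on the cells, the product of the [(1 + x_i^2)^-1]
    taken at the rounded point, whose integral is unchanged by the factor [P]. Such a weight has the
    further merit that bounded displacements change it by a bounded factor only.

    Real and imaginary parts of [eta] are treated apart; the frequencies [m] and [-m] together show
    that each part is orthogonal to the nonconstant cosines in the expansion of [P].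

    One rounded process serves all Poisson processes of intensity [lambda], since the correlations
    involved depend on [lambda] only. *)

Section tuple_measure.
Context {R : realType}.
Notation RT := (measurableTypeR R).

Lemma ge0_integral_lebesgue_tupleS n (f : n.+1.-tuple RT -> \bar R) :
  measurable_fun setT f -> (forall t, 0 <= f t)%E ->
  (\int[lebesgue_tuple n.+1]_t f t =
   \int[lebesgue_measure]_(x in [set: RT])
     \int[lebesgue_tuple n]_t f [tuple of x :: t])%E.
Proof.
move=> mf f0; rewrite /lebesgue_tuple /=.
rewrite [LHS](ge0_integral_pushforward (@measurable_cons_pair _ RT n))//.
rewrite preimage_setT fubini_tonelli1// => [|p]; last exact: f0.
exact: measurableT_comp mf (@measurable_cons_pair _ RT n).
Qed.

Lemma measurable_tuple_cons n (f : n.+1.-tuple RT -> \bar R) (x : RT) :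
  measurable_fun setT f -> measurable_fun setT (fun t : n.-tuple RT => f [tuple of x :: t]).
Proof.
by move=> mf; apply: measurableT_comp mf _; exact: measurable_cons.
Qed.

Lemma measurable_tuple_integral n (f : n.+1.-tuple RT -> \bar R) :
  measurable_fun setT f -> (forall t, 0 <= f t)%E ->
  measurable_fun setT
   (fun x : RT => (\int[lebesgue_tuple n]_t f [tuple of x :: t])%E).
Proof.
move=> mf f0.
apply: (@measurable_fun_fubini_tonelli_F _ _ _ _ _ (lebesgue_tuple n)
  (f \o @cons_pair _ RT n)) => [|p]; last exact: f0.
exact: measurableT_comp mf (@measurable_cons_pair _ RT n).
Qed.

Lemma ge0_integral_lebesgue_tuple0 (f : 0.-tuple RT -> \bar R) :
  (forall t, 0 <= f t)%E ->
  (\int[lebesgue_tuple 0]_t f t = f [tuple])%E.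
Proof.
move=> f0; rewrite /lebesgue_tuple /= integral_dirac//=.
  by rewrite diracT mul1e.
move=> _ A mA; rewrite setTI.
have [/= h|h] := pselect (A (f [tuple])).
  rewrite (_ : _ @^-1` _ = setT)//.
  by apply/seteqP; split => // t _ /=; rewrite (tuple0 t).
rewrite (_ : _ @^-1` _ = set0)//.
by apply/seteqP; split => // t /=; rewrite (tuple0 t).
Qed.

End tuple_measure.

Section boxes.
Context {R : realType}.
Notation RT := (measurableTypeR R).

Definition open_box n (p q : 'I_n -> R) : set (n.-tuple RT) :=
  [set t | forall i, p i < tnth t i < q i].

Lemma indic_open_box n (p q : 'I_n -> R) (t : n.-tuple RT) :
  \1_(open_box p q) t = \prod_i \1_(`]p i, q i[%classic) (tnth t i : R) :> R.
Proof.
have [tb|tb] := pselect (open_box p q t).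
  by rewrite indicE mem_set// big1// => i _; rewrite indicE mem_set//= in_itv/=; exact: tb.
rewrite indicE memNset//.
have [i ni] : exists i, ~ `]p i, q i[%classic (tnth t i : R).
  by apply/existsNP => h; apply: tb => i; have := h i; rewrite /= in_itv.
by rewrite (bigD1 i)//= indicE memNset// mul0r.
Qed.

Definition open_boxes n : set (set (n.-tuple RT)) :=
  [set A | exists p q : 'I_n -> R, A = open_box p q].

Lemma measurable_open_box n (p q : 'I_n -> R) : measurable (open_box p q).
Proof.
rewrite (_ : open_box p q =
  \bigcap_(i in [set: 'I_n]) (fun t => tnth t i : RT) @^-1` `]p i, q i[%classic).
  apply: fin_bigcap_measurable; first exact: finite_finset.
  move=> i _; rewrite -[X in measurable X]setTI.
  exact: measurable_tnth.
apply/seteqP; split => t /= h i; first by move=> _; rewrite /= in_itv/=; exact: h.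
by have := h i Logic.I; rewrite /= in_itv.
Qed.

Lemma open_boxes_setI n : setI_closed (@open_boxes n).
Proof.
move=> _ _ [p [q ->]] [p' [q' ->]].
exists (fun i => Num.max (p i) (p' i)), (fun i => Num.min (q i) (q' i)).
apply/seteqP; split => t /=.
  move=> [h h'] i; have /andP[? ?] := h i; have /andP[? ?] := h' i.
  by rewrite gt_max lt_min; apply/andP; split; apply/andP.
move=> h; split => i; have := h i; rewrite gt_max lt_min => /andP[/andP[? ?] /andP[? ?]];
  by apply/andP.
Qed.

Definition centered_box n (m : nat) : set (n.-tuple RT) :=
  open_box (fun=> - m%:R) (fun=> m%:R).

Lemma centered_box_nd n : nondecreasing_seq (@centered_box n).
Proof.
move=> m k mk; apply/subsetPset => t /= h i; have /andP[h1 h2] := h i.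
have mkR : m%:R <= k%:R :> R by rewrite ler_nat.
by apply/andP; split; [rewrite (le_lt_trans _ h1)// lerN2|rewrite (lt_le_trans h2)].
Qed.

Lemma in_centered_box n (t : n.-tuple RT) : exists m, centered_box m t.
Proof.
exists (Num.trunc (\sum_i `|tnth t i|)).+1 => i.
suff : `|tnth t i : R| < (Num.trunc (\sum_i `|tnth t i : R|)).+1%:R by rewrite ltr_norml.
rewrite (@le_lt_trans _ _ (\sum_i `|tnth t i : R|))//; last exact: truncnS_gt.
by rewrite (bigD1 i)//= lerDl sumr_ge0.
Qed.

Lemma bigcup_centered_box n : \bigcup_m (@centered_box n m) = [set: n.-tuple RT].
Proof.
by apply/seteqP; split => // t _; have [m ?] := in_centered_box t; exists m.
Qed.

(** The half-space where coordinate [i] exceeds [x] is the union over [m] of the boxes with lower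
    bound [x] at [i] and all other bounds [-m] or [m]. This makes the coordinates measurable for the
    sigma-algebra generated by the boxes, a pi-system to which uniqueness of measures applies. *)
Lemma measurable_tupleE n :
  (measurable : set (set (n.-tuple RT))) = <<s @open_boxes n >>.
Proof.
apply/seteqP; split; last first.
  apply: smallest_sub; first exact: sigma_algebra_measurable.
  by move=> _ [p [q ->]]; exact: measurable_open_box.
move=> A mA.
suff mid : measurable_fun setT
    ((fun t => t) : g_sigma_algebraType (@open_boxes n) -> n.-tuple RT).
  by have := mid measurableT A mA; rewrite setTI.
apply/measurable_fun_tnthP => i.
apply: (measurability _ (RGenOInfty.measurableE R)) => _ [_ [x ->] <-].
rewrite setTI (_ : _ @^-1` _ = \bigcup_m
  open_box (fun j => if j == i then x else - m%:R) (fun=> m%:R)).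
  apply: bigcupT_measurable => m; apply: sub_sigma_algebra.
  by exists (fun j => if j == i then x else - m%:R), (fun=> m%:R).
apply/seteqP; split => t /=.
  rewrite in_itv/= andbT => xt; have [m tm] := in_centered_box t; exists m => // j.
  by case: eqVneq => [->|_]; last exact: tm; rewrite xt; case/andP: (tm i).
by move=> [m _ /(_ i)]; rewrite eqxx in_itv/= => /andP[->].
Qed.

Lemma eq_measure_open_box n (m1 m2 : {measure set (n.-tuple RT) -> \bar R}) :
  (forall p q : 'I_n -> R, m1 (open_box p q) = m2 (open_box p q)) ->
  (forall k, m1 (centered_box k) < +oo)%E ->
  forall A, measurable A -> m1 A = m2 A.
Proof.
move=> m12 m1oo A mA.
apply: (measure_unique (@open_boxes n) (@centered_box n)) => //.
- exact: measurable_tupleE.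
- exact: open_boxes_setI.
- by move=> k; exists (fun=> - k%:R), (fun=> k%:R).
- exact: bigcup_centered_box.
- by move=> _ [p [q ->]]; exact: m12.
Qed.

End boxes.

Section continuous_measurable.
Context {R : realType}.
Notation RT := (measurableTypeR R).

(** Balls of the sup norm are cubes, so an open set is the union of the boxes with rational
    endpoints that it contains, and these are countably many. *)
Lemma open_measurable_rV n (U : set 'rV[R]_n) : open U ->
  measurable ((@rV_of_tuple R n) @^-1` U).
Proof.
move=> oU.
pose B (pq : {ffun 'I_n -> rat} * {ffun 'I_n -> rat}) : set (n.-tuple RT) :=
  open_box (fun i => ratr (pq.1 i)) (fun i => ratr (pq.2 i)).
pose F pq := if `[< B pq `<=` (@rV_of_tuple R n) @^-1` U >] then B pq else set0.
rewrite (_ : _ @^-1` _ = \bigcup_pq F pq).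
  apply: countable_bigcupT_measurable => [|pq]; first exact: countableP.
  by rewrite /F; case: ifPn => // _; exact: measurable_open_box.
apply/seteqP; split => t /=; last first.
  by move=> [pq _]; rewrite /F; case: asboolP => // h /h.
move=> Ut; have /nbhs_ballP[e/= e0 eU] := oU _ Ut.
have hp i : exists r : rat, (tnth t i : R) - e < ratr r < tnth t i.
  have [|r] := @rat_in_itvoo R (tnth t i - e) (tnth t i).
    by rewrite ltrBlDr ltrDl.
  by rewrite in_itv/= => ?; exists r.
have hq i : exists r : rat, (tnth t i : R) < ratr r < tnth t i + e.
  have [|r] := @rat_in_itvoo R (tnth t i) (tnth t i + e).
    by rewrite ltrDl.
  by rewrite in_itv/= => ?; exists r.
pose p := [ffun i => sval (cid (hp i))]; pose q := [ffun i => sval (cid (hq i))].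
have tB : B (p, q) t.
  move=> i; rewrite !ffunE; case: cid => /= x /andP[_ ->]; case: cid => /= y.
  by case/andP.
exists (p, q) => //; rewrite /F; case: asboolP => // -[].
move=> s Bs; apply: eU; split => // i j; rewrite !mxE.
have := Bs j; rewrite !ffunE; case: cid => /= x /andP[h1 h2]; case: cid => /= y.
move=> /andP[h3 h4] /andP[h5 h6]; rewrite /ball/= ltr_norml; lra.
Qed.

Lemma continuous_measurable_rV n (f : 'rV[R]_n -> R) : continuous f ->
  measurable_fun setT (fun t : n.-tuple RT => f (rV_of_tuple t)).
Proof.
move=> cf; apply: (measurability _ (RGenOInfty.measurableE R)) => _ [_ [x ->] <-].
rewrite setTI (_ : _ @^-1` _ = (@rV_of_tuple R n) @^-1` (f @^-1` `]x, +oo[)) //.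
apply: open_measurable_rV; apply: open_comp; last exact: interval_open.
by move=> *; exact: cf.
Qed.

End continuous_measurable.

(** * Rounding to the lattice *)

Section rounding.
Context {R : realType} (a : R).
Hypothesis a_gt0 : 0 < a.
Notation RT := (measurableTypeR R).
Implicit Types (x : R) (k : int).

(** The floor sends midpoints upwards, so the fibres are the half-open intervals [cell k], which
    partition the line. *)
Definition round x : R := a * (Num.floor (x / a + 2^-1))%:~R.

Definition cell k : set RT := `[a * k%:~R - a / 2, a * k%:~R + a / 2[%classic.

Lemma round_lattice x : lattice a (round x).
Proof. by exists (Num.floor (x / a + 2^-1)). Qed.

Lemma in_cell_floor x k : cell k x <-> Num.floor (x / a + 2^-1) = k.
Proof.
rewrite /cell/= in_itv/=; have a0 : a != 0 by rewrite gt_eqF.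
rewrite [X in X && _](_ : _ = (k%:~R <= x / a + 2^-1)); last first.
  by rewrite -[RHS](ler_pM2l a_gt0) mulrDr mulrCA divff// mulr1 lerBlDr.
rewrite [X in _ && X](_ : _ = (x / a + 2^-1 < (k + 1)%:~R)); last first.
  rewrite -[RHS](ltr_pM2l a_gt0) mulrDr mulrCA divff// mulr1.
  by rewrite intrD mulrDr mulr1 -ltrBrDr; congr (_ < _); field.
split; first exact: Num.Theory.floor_def.
by move=> <-; exact: Num.Theory.floor_itv.
Qed.

Lemma in_cell_round x k : cell k x -> round x = a * k%:~R.
Proof. by move=> /in_cell_floor; rewrite /round => ->. Qed.

Lemma cell_floor x : cell (Num.floor (x / a + 2^-1)) x.
Proof. exact/in_cell_floor. Qed.

Lemma dist_round x : `|x - round x| <= a / 2.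
Proof.
have := cell_floor x; rewrite /round /cell/= in_itv/= ler_norml => /andP[h1 h2].
by apply/andP; split; [rewrite lerBrDl//|rewrite lerBlDl ltW].
Qed.

Lemma measurable_cell k : measurable (cell k).
Proof. exact: measurable_itv. Qed.

Lemma lebesgue_measure_cell k : lebesgue_measure (cell k) = a%:E.
Proof.
have := @lebesgue_measure_itv R `[a * k%:~R - a / 2, a * k%:~R + a / 2[.
rewrite /= lte_fin ifT; last by rewrite ltrBlDr -addrA ltrDl addr_gt0// divr_gt0.
move=> ->; rewrite -EFinB; congr EFin.
by move: (a * k%:~R) => u; lra.
Qed.

(** The cells listed as a sequence, through the encoding of [int] in [nat], to express integrals as
    series; numbers that encode no integer give the empty set. *)
Definition ncell (i : nat) : set RT :=
  if (pickle_inv i : option int) is Some k then cell k else set0.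

Lemma measurable_ncell i : measurable (ncell i).
Proof. by rewrite /ncell; case: pickle_inv => // k; exact: measurable_cell. Qed.

Lemma bigcup_ncell : \bigcup_i ncell i = [set: RT].
Proof.
apply/seteqP; split => // x _.
have [i iE] : exists i, (pickle_inv i : option int) =
    Some (Num.floor ((x : R) / a + 2^-1)).
  by eexists; exact: pickleK_inv.
by exists i => //; rewrite /ncell iE; exact: cell_floor.
Qed.

Lemma trivIset_ncell : trivIset setT ncell.
Proof.
move=> i j _ _ [x []]; rewrite /ncell.
case Ei : (pickle_inv i : option int) => [k|//]; case Ej : (pickle_inv j : option int) => [l|//].
move=> /in_cell_floor kE /in_cell_floor; rewrite kE => kl; subst l.
by have := (@pickle_invK int i); rewrite Ei /= => <-; have := (@pickle_invK int j); rewrite Ej.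
Qed.

Lemma measurable_round : measurable_fun setT (round : RT -> RT).
Proof.
move=> _ Y mY; rewrite setTI (_ : _ @^-1` _ =
    \bigcup_k (if `[< Y (a * k%:~R) >] then cell k else set0)).
  apply: countable_bigcupT_measurable => [|k]; first exact: countableP.
  by case: ifPn => // _; exact: measurable_cell.
apply/seteqP; split => x /=.
  move=> Yx; exists (Num.floor ((x : R) / a + 2^-1)) => //.
  by case: asboolP => // _; exact: cell_floor.
by move=> [k _]; case: asboolP => // Yk /in_cell_round ->.
Qed.

Lemma integral_ncell (f : RT -> \bar R) :
  measurable_fun setT f -> (forall x, 0 <= f x)%E ->
  (\int[lebesgue_measure]_x f x =
   \sum_(i <oo) \int[lebesgue_measure]_(x in ncell i) f x)%E.
Proof.
move=> mf f0.
have := @ge0_integral_bigcup _ _ _ lebesgue_measure ncell f measurable_ncell.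
by rewrite bigcup_ncell => ->; [|exact: mf|move=> x _; exact: f0|exact: trivIset_ncell].
Qed.

(** On each cell [G (round x)] is constant, so only the integral of [q] over the cell matters. The
    weights in view are a Fejer kernel, with [r = 1], and the constant that bounds the kernel times
    a squared sine. *)
Lemma integral_round_weight (G : RT -> \bar R) (q : RT -> R) (r : R) :
  measurable_fun setT G -> (forall x, 0 <= G x)%E ->
  measurable_fun setT q -> (forall x, 0 <= q x) -> 0 <= r ->
  (forall k, \int[lebesgue_measure]_(x in cell k) (q x)%:E = (r * a)%:E)%E ->
  (\int[lebesgue_measure]_x (G (round x) * (q x)%:E) =
   r%:E * \int[lebesgue_measure]_(x in [set: RT]) G (round x))%E.
Proof.
move=> mG G0 mq q0 r0 qE.
have mGr : measurable_fun setT (fun x : RT => G (round x)).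
  exact: measurableT_comp mG measurable_round.
have mGrq : measurable_fun setT (fun x : RT => G (round x) * (q x)%:E)%E.
  by apply: emeasurable_funM => //; exact/measurable_EFinP.
have mqE : measurable_fun setT (fun x : RT => (q x)%:E) by exact/measurable_EFinP.
rewrite -(ge0_integralZl lebesgue_measure measurableT mGr)//.
have mrG : measurable_fun setT (fun x : RT => r%:E * G (round x))%E by exact: measurable_funeM.
rewrite (integral_ncell mGrq); last by move=> x; rewrite mule_ge0// lee_fin.
rewrite (integral_ncell mrG); last by move=> x; rewrite mule_ge0// lee_fin.
apply: eq_eseriesr => i _; rewrite /ncell.
case: pickle_inv => [k|]; last by rewrite !integral_set0.
transitivity (\int[lebesgue_measure]_(x in cell k) (G (a * k%:~R)%R * (q x)%:E))%E.
  by apply: eq_integral => x; rewrite inE => /in_cell_round ->.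
pose c := G (a * k%:~R)%R.
transitivity (c * (r * a)%:E)%E.
  rewrite -(qE k); apply: ge0_integralZl; [exact: measurable_cell|
     exact: measurable_funTS|by move=> x _; rewrite lee_fin|exact: G0].
transitivity (\int[lebesgue_measure]_(x in cell k) (cst (r%:E * c) x))%E; last first.
  by apply: eq_integral => x; rewrite inE => /in_cell_round ->.
rewrite integral_cst; last exact: measurable_cell.
rewrite [X in (_ = _ * X)%E](lebesgue_measure_cell k).
by rewrite EFinM muleA (muleC c).
Qed.

Definition round_tuple n (t : n.-tuple RT) : n.-tuple RT :=
  [tuple of map round t].

Lemma measurable_round_tuple n : measurable_fun setT (@round_tuple n).
Proof.
apply/measurable_fun_tnthP => i.
rewrite (_ : _ \o _ = round \o (fun t => tnth t i)).
  by apply: measurableT_comp measurable_round _; exact: measurable_tnth.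
by apply/funext => t /=; rewrite tnth_map.
Qed.

End rounding.

Section product_weights.
Context {R : realType}.
Notation RT := (measurableTypeR R).

Lemma tnth_cons_lift n (x : RT) (t : n.-tuple RT) (i : 'I_n) :
  tnth [tuple of x :: t] (lift ord0 i) = tnth t i.
Proof. by rewrite tnthS. Qed.

Lemma round_tuple_cons (a : R) n (x : RT) (t : n.-tuple RT) :
  round_tuple a [tuple of x :: t] = [tuple of round a x :: round_tuple a t].
Proof. exact: val_inj. Qed.

Lemma measurable_tuple_prod n (q : 'I_n -> RT -> R) :
  (forall i, measurable_fun setT (q i)) ->
  measurable_fun setT (fun t : n.-tuple RT => \prod_i q i (tnth t i)).
Proof.
move=> mq; apply: measurable_prod => i _.
by apply: measurableT_comp (mq i) _; exact: measurable_tnth.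
Qed.

(** Induction on the dimension from [integral_round_weight]. Each coordinate has its own weight
    because [integral_round_fejer_sin] changes the weight of a single coordinate. *)
Lemma integral_round_tuple_weight (a : R) n (q : 'I_n -> RT -> R)
    (r : 'I_n -> R) (H : n.-tuple RT -> \bar R) : 0 < a ->
  measurable_fun setT H -> (forall t, 0 <= H t)%E ->
  (forall i, measurable_fun setT (q i)) -> (forall i x, 0 <= q i x) ->
  (forall i, 0 <= r i) ->
  (forall i k, \int[lebesgue_measure]_(x in cell a k) (q i x)%:E =
     (r i * a)%:E)%E ->
  (\int[lebesgue_tuple n]_t
     (H (round_tuple a t) * (\prod_i q i (tnth t i))%:E) =
   (\prod_i r i)%:E * \int[lebesgue_tuple n]_t H (round_tuple a t))%E.
Proof.
move=> a0; elim: n => [|n IH] in q r H *.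
  move=> mH H0 _ _ _ _; rewrite !ge0_integral_lebesgue_tuple0//.
    by rewrite !big_ord0 mule1 mul1e.
  by move=> t; apply: mule_ge0; [exact: H0|rewrite lee_fin big_ord0].
move=> mH H0 mq q0 r0 qE.
have mHr : measurable_fun setT (fun t => H (round_tuple a t)).
  by apply: (measurableT_comp mH); exact: (@measurable_round_tuple _ a a0 n.+1).
have mHrq : measurable_fun setT (fun t : n.+1.-tuple RT =>
    H (round_tuple a t) * (\prod_i q i (tnth t i))%:E)%E.
  by apply: emeasurable_funM => //; apply/measurable_EFinP; exact: measurable_tuple_prod.
have Hrq0 t : (0 <= H (round_tuple a t) * (\prod_i q i (tnth t i))%:E)%E.
  by rewrite mule_ge0// lee_fin prodr_ge0.
rewrite ge0_integral_lebesgue_tupleS//.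
rewrite [in RHS]ge0_integral_lebesgue_tupleS//.
(* The rounded coordinates after the first are integrated out, which leaves the one-dimensional
   statement to be applied to [G]. *)
pose G (y : RT) := (\int[lebesgue_tuple n]_t H [tuple of y :: round_tuple a t])%E.
have G0 y : (0 <= G y)%E by exact: integral_ge0.
have mcons : measurable_fun setT
    (fun t : n.+1.-tuple RT => [tuple of thead t :: round_tuple a [tuple of behead t]]).
  apply: measurable_cons; first exact: (@measurable_tnth _ RT n.+1 ord0).
  apply: measurableT_comp; first exact: measurable_round_tuple.
  exact: measurable_behead.
have mG : measurable_fun setT G.
  rewrite (_ : G = fun y => \int[lebesgue_tuple n]_t
    (fun s => H [tuple of thead s :: round_tuple a [tuple of behead s]]) [tuple of y :: t])%E.
    apply: (@measurable_tuple_integral _ n (fun s => H [tuple of thead s ::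
        round_tuple a [tuple of behead s]])) => [|t]; last exact: H0.
    exact: (measurableT_comp mH mcons).
  apply/funext => y; apply: eq_integral => t _; congr H; apply: val_inj => /=.
  by rewrite theadE.
transitivity (\int[lebesgue_measure]_(x in [set: RT])
   ((\prod_i r (lift ord0 i))%:E * (G (round a x) * (q ord0 x)%:E)))%E.
  apply: eq_integral => x _.
  transitivity ((q ord0 x)%:E * \int[lebesgue_tuple n]_t
     (H [tuple of round a x :: round_tuple a t] *
       (\prod_i q (lift ord0 i) (tnth t i))%:E))%E.
    rewrite -ge0_integralZl//.
    - apply: eq_integral => t _.
      rewrite round_tuple_cons big_ord_recl EFinM muleCA; congr (_ * (_ * _))%E.
      by congr EFin; apply: eq_bigr => i _; rewrite tnth_cons_lift.
    - apply: emeasurable_funM.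
        apply: (measurableT_comp mH); apply: measurable_cons; first exact: measurable_cst.
        exact: (@measurable_round_tuple _ a a0 n).
      by apply/measurable_EFinP; exact: (measurable_tuple_prod (q := fun i => q (lift ord0 i))).
    - by move=> t _; rewrite mule_ge0// lee_fin prodr_ge0.
    - by rewrite lee_fin.
  have := IH (fun i => q (lift ord0 i)) (fun i => r (lift ord0 i))
    (fun t => H [tuple of round a x :: t]).
  move=> /= ->//.
  - by rewrite -/(G _) muleCA; congr (_ * _)%E; rewrite muleC.
  - exact: measurable_tuple_cons.
have mGrx : measurable_fun setT (fun x : RT => G (round a x) * (q ord0 x)%:E)%E.
  apply: emeasurable_funM; last exact/measurable_EFinP.
  exact: measurableT_comp mG (measurable_round a0).
rewrite ge0_integralZl//.
- rewrite (@integral_round_weight _ a a0 G (q ord0) (r ord0))//.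
  rewrite muleA -EFinM mulrC -big_ord_recl; congr (_ * _)%E.
  apply: eq_integral => x _; apply: eq_integral => t _.
  by rewrite round_tuple_cons.
- by move=> x _; rewrite mule_ge0// lee_fin.
- by rewrite lee_fin prodr_ge0.
Qed.

Lemma integral_prod_lebesgue_tuple n (q : 'I_n -> RT -> R) :
  (forall i, measurable_fun setT (q i)) -> (forall i x, 0 <= q i x) ->
  (\int[lebesgue_tuple n]_t (\prod_i q i (tnth t i))%:E =
   \prod_i \int[lebesgue_measure]_(x in [set: RT]) (q i x)%:E)%E.
Proof.
elim: n => [|n IH] in q *.
  move=> _ _; rewrite ge0_integral_lebesgue_tuple0//.
    by rewrite !big_ord0.
  by move=> t; rewrite lee_fin big_ord0.
move=> mq q0.
rewrite ge0_integral_lebesgue_tupleS//; last 2 first.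
- by apply/measurable_EFinP; exact: measurable_tuple_prod.
- by move=> t; rewrite lee_fin prodr_ge0.
rewrite big_ord_recl -IH//.
transitivity (\int[lebesgue_measure]_(x in [set: RT])
   ((q ord0 x)%:E * \int[lebesgue_tuple n]_t (\prod_i q (lift ord0 i) (tnth t i))%:E))%E.
  apply: eq_integral => x _; rewrite -ge0_integralZl//.
  - apply: eq_integral => t _; rewrite big_ord_recl EFinM; congr (_ * _)%E.
    by congr EFin; apply: eq_bigr => i _; rewrite tnth_cons_lift.
  - apply/measurable_EFinP.
    exact: (measurable_tuple_prod (q := fun i => q (lift ord0 i))).
  - by move=> t _; rewrite lee_fin prodr_ge0.
  - by rewrite lee_fin.
rewrite ge0_integralZr//.
- exact/measurable_EFinP.
- by move=> x _; rewrite lee_fin.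
- by apply: integral_ge0 => t _; rewrite lee_fin prodr_ge0.
Qed.

End product_weights.

(** * Fejer kernels *)

Section fejer.
Context {R : realType} (a : R).
Hypothesis a_gt0 : 0 < a.
Implicit Types (x t : R) (k : int).

Lemma sin_intpi k : sin (pi * k%:~R) = 0 :> R.
Proof.
have H (m : nat) : sin (pi * m%:R) = 0 :> R.
  elim: m => [|m IH]; first by rewrite mulr0 sin0.
  by rewrite -natr1 mulrDr mulr1 sinDpi IH oppr0.
by case: (intP k) => [|m|m]; rewrite ?mulr0 ?sin0// ?rmorphN/= ?mulrN ?sinN; rewrite -pmulrn H ?oppr0.
Qed.

Definition trig_mono k t : R := cos (2 * pi * k%:~R * t / a).

Lemma continuous_trig_mono k : continuous (trig_mono k).
Proof.
move=> t; apply: continuous_comp; last exact: continuous_cos.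
by apply: cvgMl; apply: cvgMr; exact: cvg_id.
Qed.

Definition trig_prim k t : R :=
  if k == 0 then t else (2 * pi * k%:~R / a)^-1 * sin (2 * pi * k%:~R / a * t).

Lemma is_derive_trig_prim k t : is_derive t 1 (trig_prim k) (trig_mono k t).
Proof.
rewrite /trig_prim /trig_mono; case: eqVneq => [->|k0].
  by rewrite mulr0 !mul0r cos0; exact: is_derive_id.
set c := 2 * pi * k%:~R / a.
have c0 : c != 0.
  by rewrite !mulf_neq0 ?intr_eq0// ?invr_neq0// gt_eqF// pi_gt0.
rewrite (_ : cos _ = c^-1 *: (cos (c * t) * c)); last first.
  by rewrite /GRing.scale/= mulrCA mulVf// mulr1 mulrAC.
apply: is_deriveZ; apply: (is_derive1_comp (f := sin) (g := *%R c)).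
rewrite -[X in is_derive _ _ _ X]mulr1; apply: (is_deriveZ (f := id)).
Qed.

(** A nonzero frequency completes whole periods on a cell, so its integral there vanishes; the zero
    frequency contributes the length [a]. *)
Lemma trig_primB k l :
  trig_prim k (a * l%:~R + a / 2) - trig_prim k (a * l%:~R - a / 2) = (k == 0)%:R * a.
Proof.
have a0 : a != 0 by rewrite gt_eqF.
rewrite /trig_prim; case: eqVneq => [_|k0].
  by rewrite mul1r; field.
set c := 2 * pi * k%:~R / a.
rewrite mul0r -mulrBr [c * (_ + _)]mulrDr [c * (_ - _)]mulrBr sinD sinB.
rewrite (_ : c * (a / 2) = pi * k%:~R); last by rewrite /c; move: (k%:~R : R) => z; field.
by rewrite sin_intpi !mulr0 addr0 subr0 subrr mulr0.
Qed.

(* The square of the modulus of the sum of [e^(2 i pi j t / a)] over [j <= N],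
   divided by [N + 1]; see [fejer_sqr]. *)
Definition fejer (N : nat) t : R :=
  N.+1%:R^-1 * \sum_(j < N.+1) \sum_(l < N.+1) trig_mono (j%:Z - l%:Z) t.

Definition fejer_prim (N : nat) : R -> R :=
  N.+1%:R^-1 *: \sum_(j < N.+1) \sum_(l < N.+1) trig_prim (j%:Z - l%:Z).

Lemma is_derive_fejer_prim N t : is_derive t 1 (fejer_prim N) (fejer N t).
Proof.
apply: is_deriveZ; apply: is_derive_sum => j; apply: is_derive_sum => l.
exact: is_derive_trig_prim.
Qed.

Lemma continuous_fejer N : continuous (fejer N).
Proof.
move=> t; rewrite /fejer; apply: cvgMr; apply: cvg_big => [|j _]; first exact: add_continuous.
apply: cvg_big => [|l _]; first exact: add_continuous.
exact: continuous_trig_mono.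
Qed.

Lemma measurable_fejer N : measurable_fun setT (fejer N : measurableTypeR R -> measurableTypeR R).
Proof. exact: (continuous_measurable_fun (@continuous_fejer N)). Qed.

(** Only the [N.+1] diagonal pairs [j = l] have frequency zero, and each contributes [a]; the
    normalization cancels their number. *)
Lemma fejer_primB N l :
  fejer_prim N (a * l%:~R + a / 2) - fejer_prim N (a * l%:~R - a / 2) = a.
Proof.
rewrite /fejer_prim -mulrBr !fct_sumE -sumrB.
under eq_bigr => j _.
  rewrite !fct_sumE -sumrB.
  under eq_bigr => i _ do rewrite trig_primB subr_eq0 eqz_nat.
  rewrite (bigD1 j)//= eqxx mul1r big1 ?addr0; last first.
    by move=> i ij; rewrite (_ : (j == i :> nat) = false) ?mul0r// eq_sym; apply/negbTE.
  over.
by rewrite sumr_const card_ord -[X in _ * X]mulr_natl mulrA mulVf ?mul1r.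
Qed.

Lemma integral_fejer N k :
  (\int[lebesgue_measure]_(x in cell a k) (fejer N x)%:E = a%:E)%E.
Proof.
have lt : a * k%:~R - a / 2 < a * k%:~R + a / 2.
  by rewrite ltrBlDr -addrA ltrDl addr_gt0// divr_gt0.
have mf : measurable_fun setT (EFin \o fejer N : measurableTypeR R -> \bar R).
  by apply/measurable_EFinP; exact: measurable_fejer.
rewrite /cell integral_itv_bndo_bndc; last exact: measurable_funTS.
have cP : continuous (fejer_prim N).
  by move=> t; have [/derivable1_diffP/differentiable_continuous] := is_derive_fejer_prim N t.
rewrite (@continuous_FTC2 _ _ (fejer_prim N))//.
- by rewrite -EFinB fejer_primB.
- exact: continuous_subspaceT (@continuous_fejer N).
- split.
  + by move=> x _; have [] := is_derive_fejer_prim N x.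
  + by apply: cvg_at_right_filter; exact: cP.
  + by apply: cvg_at_left_filter; exact: cP.
- by move=> x _; rewrite derive1E; have [_ ->] := is_derive_fejer_prim N x.
Qed.

Lemma trig_monoB (j l : int) t :
  trig_mono (j - l) t = trig_mono j t * trig_mono l t +
    sin (2 * pi * j%:~R * t / a) * sin (2 * pi * l%:~R * t / a).
Proof. by rewrite /trig_mono -cosB; congr cos; rewrite intrB; ring. Qed.

(** The squared modulus form gives the positivity of the kernel, invisible on the double sum, and
    the bound [fejer_sin]. *)
Lemma fejer_sqr N t : fejer N t = N.+1%:R^-1 *
  ((\sum_(j < N.+1) trig_mono j%:Z t) ^+ 2 +
   (\sum_(j < N.+1) sin (2 * pi * j%:~R * t / a)) ^+ 2).
Proof.
rewrite /fejer; congr (_ * _).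
rewrite !expr2 !mulr_suml -big_split/=; apply: eq_bigr => j _.
rewrite !mulr_sumr -big_split/=; apply: eq_bigr => l _.
exact: trig_monoB.
Qed.

Lemma fejer_ge0 N t : 0 <= fejer N t.
Proof. by rewrite fejer_sqr mulr_ge0 ?invr_ge0// addr_ge0// sqr_ge0. Qed.

(** Telescoping: [2 * sin h * cos (2 * j * h)] is [sin ((2 * j + 1) * h) - sin ((2 * j - 1) * h)].
    The next lemma uses the analogous identity for sines. *)
Lemma sin_sum_cos N (h : R) :
  2 * sin h * \sum_(j < N) cos (2 * j%:R * h) = sin ((2 * N%:R - 1) * h) + sin h.
Proof.
elim: N => [|N IH]; first by rewrite big_ord0 !mulr0 sub0r mulN1r sinN addNr.
rewrite big_ord_recr/= mulrDr IH.
rewrite (_ : (2 * N%:R - 1) * h = 2 * N%:R * h - h); last by ring.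
rewrite (_ : (2 * N.+1%:R - 1) * h = 2 * N%:R * h + h); last by rewrite -natr1; ring.
by rewrite sinB sinD; ring.
Qed.

Lemma sin_sum_sin N (h : R) :
  2 * sin h * \sum_(j < N) sin (2 * j%:R * h) = cos h - cos ((2 * N%:R - 1) * h).
Proof.
elim: N => [|N IH]; first by rewrite big_ord0 !mulr0 sub0r mulN1r cosN subrr.
rewrite big_ord_recr/= mulrDr IH.
rewrite (_ : (2 * N%:R - 1) * h = 2 * N%:R * h - h); last by ring.
rewrite (_ : (2 * N.+1%:R - 1) * h = 2 * N%:R * h + h); last by rewrite -natr1; ring.
by rewrite cosB cosD; ring.
Qed.

(** The squared modulus of the geometric sum times [sin h ^+ 2] equals [sin (N.+1 * h) ^+ 2], hence
    is at most 1. Off the lattice the kernel therefore decays like the inverse of [N]. *)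
Lemma fejer_sin N t : fejer N t * sin (pi * t / a) ^+ 2 <= N.+1%:R^-1.
Proof.
set h := pi * t / a.
have argE (j : 'I_N.+1) : 2 * pi * j%:~R * t / a = 2 * j%:R * h.
  by rewrite /h -pmulrn; ring.
rewrite fejer_sqr /trig_mono; under eq_bigr => j _ do rewrite argE.
under [X in _ + X ^+ 2]eq_bigr => j _ do rewrite argE.
rewrite -mulrA ler_piMr ?invr_ge0//.
have := sin_sum_cos N.+1 h; have := sin_sum_sin N.+1 h.
set C := \sum_(j < _) cos _; set S := \sum_(j < _) sin _.
set g := (2 * _ - 1) * h => hS hC.
(* Here [g + h] is [2 * N.+1 * h], so the right-hand side is [4 * sin (N.+1 * h) ^+ 2]. *)
have h2 : 4 * ((C ^+ 2 + S ^+ 2) * sin h ^+ 2) = 2 - 2 * cos (g + h).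
  transitivity ((2 * sin h * C) ^+ 2 + (2 * sin h * S) ^+ 2); first by ring.
  rewrite hC hS cosD; have := cos2Dsin2 h; have := cos2Dsin2 g; nra.
have := cos_geN1 (g + h); lra.
Qed.

End fejer.

(** * An integrable weight stable under bounded displacements *)

Section weight.
Context {R : realType}.
Notation RT := (measurableTypeR R).
Implicit Types (x y : R).

Definition weight x : R := (oneDsqr x)^-1.

Lemma weight_gt0 x : 0 < weight x.
Proof. by rewrite invr_gt0 (lt_le_trans ltr01)// oneDsqr_ge1. Qed.

Lemma weight_ge0 x : 0 <= weight x. Proof. exact/ltW/weight_gt0. Qed.

Lemma measurable_weight : measurable_fun setT (weight : RT -> RT).
Proof.
by apply: continuous_measurable_fun => x; exact: continuous_oneDsqrV.
Qed.

(** The constant comes from [y ^+ 2 <= 2 * x ^+ 2 + 2 * (x - y) ^+ 2], which gives [1 + y ^+ 2 <= (2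
    + 2 * r ^+ 2) * (1 + x ^+ 2)]. *)
Lemma weight_near (r : R) x y : `|x - y| <= r ->
  weight x <= (2 + 2 * r ^+ 2) * weight y.
Proof.
move=> xy; rewrite /weight ler_pdivlMr ?oneDsqr_gt0// mulrC ler_pdivrMr ?oneDsqr_gt0//.
have r2 : (x - y) ^+ 2 <= r ^+ 2 by rewrite -real_normK ?num_real// ler_sqr ?nnegrE// (le_trans _ xy).
rewrite /oneDsqr; nra.
Qed.

Lemma integral_weight_lty : (\int[lebesgue_measure]_x (weight x)%:E < +oo)%E.
Proof.
rewrite ge0_symfun_integralT//.
- by rewrite -set_itvcy [X in (_ * X)%E]integral0y_oneDsqr -EFinM ltry.
- by move=> x; exact: weight_ge0.
- by move=> x; exact: continuous_oneDsqrV.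
- by move=> x; rewrite /weight /oneDsqr/= sqrrN.
Qed.

Definition tuple_weight n (t : n.-tuple RT) : R := \prod_i weight (tnth t i).

Lemma tuple_weight_gt0 n (t : n.-tuple RT) : 0 < tuple_weight t.
Proof. by apply: prodr_gt0 => i _; exact: weight_gt0. Qed.

Lemma tuple_weight_ge0 n (t : n.-tuple RT) : 0 <= tuple_weight t.
Proof. exact/ltW/tuple_weight_gt0. Qed.

Lemma measurable_tuple_weight n : measurable_fun setT (@tuple_weight n).
Proof. exact: (measurable_tuple_prod (fun=> measurable_weight)). Qed.

Lemma integral_tuple_weight_lty n :
  (\int[lebesgue_tuple n]_t (tuple_weight t)%:E < +oo)%E.
Proof.
rewrite (integral_prod_lebesgue_tuple (q := fun=> weight)).
- rewrite big_const_ord; elim: n => [|n IH]; first by rewrite ltry.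
  rewrite iterS; apply: lte_mul_pinfty => //.
  + by apply: integral_ge0 => x _; rewrite lee_fin weight_ge0.
  + rewrite ge0_fin_numE; first exact: integral_weight_lty.
    by apply: integral_ge0 => x _; rewrite lee_fin weight_ge0.
- by move=> _; exact: measurable_weight.
- by move=> _ x; exact: weight_ge0.
Qed.

Lemma integrable_le_tuple_weight n (F : n.-tuple RT -> R) C :
  measurable_fun setT F -> (forall t, `|F t| <= C * tuple_weight t) ->
  (lebesgue_tuple n).-integrable setT (fun t => (F t)%:E).
Proof.
move=> mF FC.
have iW : (lebesgue_tuple n).-integrable setT (fun t => (tuple_weight t)%:E).
  apply/integrableP; split.
    by apply/measurable_EFinP; exact: measurable_tuple_weight.
  under eq_integral do rewrite abse_EFin ger0_norm ?tuple_weight_ge0//.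
  exact: integral_tuple_weight_lty.
apply: (le_integrable measurableT _ _ (integrableZl measurableT C iW)).
  exact/measurable_EFinP.
move=> t _; rewrite -EFinM !abse_EFin lee_fin.
by rewrite (le_trans (FC t))// ler_norm.
Qed.

Lemma tuple_weight_near n (r : R) (s t : n.-tuple RT) :
  (forall i, `|(tnth s i : R) - tnth t i| <= r) ->
  tuple_weight s <= (2 + 2 * r ^+ 2) ^+ n * tuple_weight t.
Proof.
move=> st; rewrite /tuple_weight -[X in _ ^+ X](card_ord n) -prodr_const -big_split/=.
by apply: ler_prod => i _; rewrite weight_ge0 weight_near.
Qed.

End weight.

Section rounding_error.
Context {R : realType} (a : R).
Hypothesis a_gt0 : 0 < a.

Lemma sin2Dintpi (x : R) (k : int) : sin (x + pi * k%:~R) ^+ 2 = sin x ^+ 2.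
Proof.
rewrite sinD sin_intpi mulr0 addr0 exprMn.
have := cos2Dsin2 (pi * k%:~R : R); rewrite sin_intpi expr0n/= addr0 => ->.
by rewrite mulr1.
Qed.

(** Within [e] of the lattice the first term suffices. Farther away the squared sine, a function of
    the distance to the lattice, is at least [m ^+ 2], while the distance is at most [a / 2]; hence
    [M = a / 2 / m ^+ 2]. *)
Lemma dist_round_sin (e : R) : 0 < e -> exists2 M : R, 0 <= M &
  forall x, `|x - round a x| <= e + M * sin (pi * x / a) ^+ 2.
Proof.
(* The cap at [a / 2] keeps [pi * d / a] between 0 and [pi / 2], where the sine increases. *)
move=> e0; pose d := Num.min e (a / 2).
have d0 : 0 < d by rewrite lt_min e0 divr_gt0.
have da2 : d <= a / 2 by rewrite ge_min lexx orbT.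
have [pi0 a0] : 0 < (pi : R) /\ a != 0 by rewrite pi_gt0 gt_eqF.
have angle (y : R) : 0 < y -> y <= a / 2 -> 0 < pi * y / a <= pi / 2.
  move=> y0 ya; rewrite divr_gt0 ?mulr_gt0//= ler_pdivrMr//.
  by rewrite mulrAC -mulrA ler_pM2l.
pose m := sin (pi * d / a).
have m0 : 0 < m.
  apply: sin_gt0_pi; have /andP[-> h] := angle d d0 da2.
  by rewrite (le_lt_trans h)// ltr_pdivrMr// ltr_pMr// ltr1n.
exists (a / 2 / m ^+ 2) => [|x]; first by rewrite !divr_ge0 ?exprn_ge0// ltW.
have sE : sin (pi * x / a) ^+ 2 = sin (pi * `|x - round a x| / a) ^+ 2.
  transitivity (sin (pi * (x - round a x) / a) ^+ 2).
    rewrite -[RHS](sin2Dintpi _ (Num.floor (x / a + 2^-1))); congr (sin _ ^+ 2).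
    by rewrite /round; move: (_%:~R) => z; field.
  have [h|h] := lerP 0 (x - round a x); first by rewrite ger0_norm.
  by rewrite ltr0_norm// mulrN mulNr sinN sqrrN.
rewrite sE; have := dist_round a_gt0 x; move: (`|x - round a x| : R) (normr_ge0 (x - round a x)).
move=> y y0 ya.
have [ye|ye] := leP y e; first by rewrite (le_trans ye)// lerDl mulr_ge0 ?sqr_ge0// !divr_ge0 ?exprn_ge0// ltW.
have dy : d <= y by rewrite ge_min (ltW ye).
have y_gt0 : 0 < y by rewrite (lt_le_trans d0).
have my : m <= sin (pi * y / a).
  have inI (z : R) : 0 < z -> z <= a / 2 -> pi * z / a \in `[- (pi / 2), pi / 2].
    move=> z0 za; have /andP[h1 h2] := angle z z0 za.
    by rewrite in_itv/= h2 andbT (le_trans _ (ltW h1))// oppr_le0 divr_ge0// ltW.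
  rewrite /m leNgt ltr_sin ?inI// -leNgt.
  by rewrite ler_pM2r ?invr_gt0// ler_pM2l.
rewrite (le_trans ya)//; apply: (@le_trans _ _ (a / 2 / m ^+ 2 * sin (pi * y / a) ^+ 2)).
  have m20 : 0 < m ^+ 2 by rewrite exprn_gt0.
  rewrite -[leLHS](@divfK _ (m ^+ 2)) ?gt_eqF// ler_wpM2l//.
    by rewrite !divr_ge0 ?ltW.
  by rewrite lerXn2r// nnegrE ltW// (lt_le_trans m0).
by rewrite lerDr ltW.
Qed.

End rounding_error.

(** * Products of Fejer kernels integrated against functions of the rounded tuple *)

Section fejer_summation.
Context {R : realType} (a : R).
Hypothesis a_gt0 : 0 < a.
Notation RT := (measurableTypeR R).
Variable n : nat.
Implicit Types (t : n.-tuple RT).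

Definition fejer_tuple N t : R := \prod_i fejer a N (tnth t i).

(** Constant on the cells, so that the factor [fejer_tuple] leaves its integral unchanged, yet
    within constant factors of [tuple_weight]. *)
Definition lattice_weight t : R := tuple_weight (round_tuple a t).

Lemma fejer_tuple_ge0 N t : 0 <= fejer_tuple N t.
Proof. by apply: prodr_ge0 => i _; exact: fejer_ge0. Qed.

Lemma measurable_fejer_tuple N : measurable_fun setT (fejer_tuple N).
Proof.
exact: (measurable_tuple_prod (fun=> @measurable_fejer _ a N)).
Qed.

Lemma lattice_weight_ge0 t : 0 <= lattice_weight t.
Proof. exact: tuple_weight_ge0. Qed.

Lemma measurable_lattice_weight : measurable_fun setT lattice_weight.
Proof.
exact: measurableT_comp (@measurable_tuple_weight R n) (@measurable_round_tuple _ a a_gt0 n).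
Qed.

Lemma lattice_weight_near t :
  lattice_weight t <= (2 + 2 * (a / 2) ^+ 2) ^+ n * tuple_weight t.
Proof.
apply: tuple_weight_near => i; rewrite tnth_map distrC; exact: dist_round.
Qed.

Lemma lattice_weight_ge t :
  tuple_weight t <= (2 + 2 * (a / 2) ^+ 2) ^+ n * lattice_weight t.
Proof.
apply: tuple_weight_near => i; rewrite tnth_map; exact: dist_round.
Qed.

Lemma integral_lattice_weight_lty :
  (\int[lebesgue_tuple n]_t (lattice_weight t)%:E < +oo)%E.
Proof.
set c := (2 + 2 * (a / 2) ^+ 2) ^+ n.
have c0 : 0 <= c by rewrite exprn_ge0// addr_ge0// mulr_ge0 ?sqr_ge0.
apply: (@le_lt_trans _ _ (\int[lebesgue_tuple n]_t (c%:E * (tuple_weight t)%:E))%E).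
  apply: ge0_le_integral => //.
  - by move=> t _; rewrite lee_fin lattice_weight_ge0.
  - by apply/measurable_EFinP; exact: measurable_lattice_weight.
  - by apply: measurable_funeM; apply/measurable_EFinP; exact: measurable_tuple_weight.
  - by move=> t _; rewrite -EFinM lee_fin lattice_weight_near.
rewrite ge0_integralZl//.
- apply: lte_mul_pinfty; [by rewrite lee_fin|by []|exact: integral_tuple_weight_lty].
- by apply/measurable_EFinP; exact: measurable_tuple_weight.
- by move=> t _; rewrite lee_fin tuple_weight_ge0.
Qed.

Lemma integral_round_fejer N (H : n.-tuple RT -> \bar R) :
  measurable_fun setT H -> (forall t, 0 <= H t)%E ->
  (\int[lebesgue_tuple n]_t (H (round_tuple a t) * (fejer_tuple N t)%:E) =
   \int[lebesgue_tuple n]_t H (round_tuple a t))%E.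
Proof.
move=> mH H0.
rewrite (@integral_round_tuple_weight _ a n (fun=> fejer a N) (fun=> 1) H)//.
- by rewrite big1 ?mul1e.
- by move=> _; exact: measurable_fejer.
- by move=> _ x; exact: fejer_ge0.
- by move=> _ k; rewrite mul1r integral_fejer.
Qed.

(** By [fejer_sin], the kernel of coordinate [i] together with its sine is bounded by the constant
    [N.+1%:R^-1]; the other kernels keep mass [a] on each cell. *)
Lemma integral_round_fejer_sin N (i : 'I_n) :
  (\int[lebesgue_tuple n]_t (lattice_weight t * (fejer_tuple N t * sin (pi * tnth t i / a) ^+ 2))%:E
   <= N.+1%:R^-1%:E * \int[lebesgue_tuple n]_t (lattice_weight t)%:E)%E.
Proof.
pose q j : RT -> R := if j == i then fun=> N.+1%:R^-1 else fejer a N.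
have mq j : measurable_fun setT (q j).
  by rewrite /q; case: ifP => _; [exact: measurable_cst|exact: measurable_fejer].
have q0 j x : 0 <= q j x by rewrite /q; case: ifP => _; [rewrite invr_ge0|exact: fejer_ge0].
pose r (j : 'I_n) : R := if j == i then N.+1%:R^-1 else 1.
have <- : \prod_j r j = N.+1%:R^-1.
  rewrite (bigD1 i)//= /r eqxx big1 ?mulr1// => j /negbTE ji.
  by rewrite ji.
rewrite -(@integral_round_tuple_weight _ a n q r (EFin \o @tuple_weight R n))//.
- apply: ge0_le_integral => //.
  + move=> t _; rewrite lee_fin; apply: mulr_ge0; first exact: lattice_weight_ge0.
    by apply: mulr_ge0; [exact: fejer_tuple_ge0|exact: sqr_ge0].
  + apply/measurable_EFinP; apply: measurable_funM; first exact: measurable_lattice_weight.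
    apply: measurable_funM; first exact: measurable_fejer_tuple.
    apply: measurable_funX; apply: measurableT_comp; first exact: (continuous_measurable_fun (@continuous_sin R)).
    apply: measurable_funM; last exact: measurable_cst.
    by apply: measurable_funM; [exact: measurable_cst|exact: (@measurable_tnth _ RT n i)].
  + apply: emeasurable_funM.
      by apply/measurable_EFinP; exact: measurable_lattice_weight.
    by apply/measurable_EFinP; exact: measurable_tuple_prod.
  + move=> t _; rewrite -EFinM lee_fin ler_wpM2l ?tuple_weight_ge0//.
    rewrite /fejer_tuple (bigD1 i)//= [leRHS](bigD1 i)//= /q eqxx mulrAC.
    apply: ler_pM.
    * by apply: mulr_ge0; [exact: fejer_ge0|exact: sqr_ge0].
    * by apply: prodr_ge0 => j _; exact: fejer_ge0.
    * exact: fejer_sin.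
    * by apply: ler_prod => j /negbTE ->; rewrite fejer_ge0 lexx.
- by apply/measurable_EFinP; exact: measurable_tuple_weight.
- by move=> t; rewrite lee_fin tuple_weight_ge0.
- by move=> j; rewrite /r; case: ifP => _ //; rewrite invr_ge0.
- move=> j k; rewrite /q /r; case: ifP => _; last by rewrite mul1r integral_fejer.
  rewrite integral_cst; last exact: measurable_cell.
  by rewrite [X in (_ * X = _)%E](lebesgue_measure_cell a_gt0 k).
Qed.

End fejer_summation.

(** * Integrals of a function and of its rounding agree in the limit *)

Section fejer_limit.
Context {R : realType} (a : R).
Hypothesis a_gt0 : 0 < a.
Notation RT := (measurableTypeR R).
Variable n : nat.
Notation mu := (@lebesgue_tuple R n).
Notation P := (@fejer_tuple R a n).
Notation K := (@lattice_weight R a n).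
Notation rd := (@round_tuple R a n).
Variables (F : n.-tuple RT -> R) (C L : R).
Hypothesis mF : measurable_fun setT F.
Hypothesis F_le : forall t, `|F t| <= C * tuple_weight t.

Let c := (2 + 2 * (a / 2) ^+ 2) ^+ n.
Let c_ge0 : 0 <= c.
Proof. by rewrite exprn_ge0// addr_ge0// mulr_ge0 ?sqr_ge0. Qed.

Let C_ge0 : 0 <= C.
Proof.
have t : n.-tuple RT := [tuple of nseq n 0].
have := le_trans (normr_ge0 _) (F_le t).
by rewrite pmulr_lge0// tuple_weight_gt0.
Qed.

Let F_leK t : `|F t| <= C * c * K t.
Proof.
by rewrite (le_trans (F_le t))// -mulrA ler_wpM2l// lattice_weight_ge.
Qed.

Let Frd_leK t : `|F (rd t)| <= C * c * K t.
Proof.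
rewrite (le_trans (F_le _))// -mulrA ler_wpM2l// -[leLHS]mul1r ler_wpM2r//.
  exact: lattice_weight_ge0.
rewrite exprn_ege1//; have := sqr_ge0 (a / 2); lra.
Qed.

Lemma integrable_le_weight (G Q : n.-tuple RT -> R) D :
  measurable_fun setT G -> measurable_fun setT Q ->
  (forall t, 0 <= Q t) ->
  (\int[mu]_t (K t * Q t)%:E < +oo)%E -> (forall t, `|G t| <= D * K t) ->
  mu.-integrable setT (fun t => (G t * Q t)%:E).
Proof.
move=> mG mQ Q0 KQ GD.
have mKQ : measurable_fun setT (fun t => K t * Q t).
  by apply: measurable_funM => //; exact: measurable_lattice_weight.
have iKQ : mu.-integrable setT (fun t => (K t * Q t)%:E).
  apply/integrableP; split; first exact/measurable_EFinP.
  rewrite (eq_integral (fun t => (K t * Q t)%:E))// => t _.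
  by rewrite abse_EFin ger0_norm// mulr_ge0// lattice_weight_ge0.
apply: (le_integrable measurableT _ _ (integrableZl measurableT D iKQ)).
  by apply/measurable_EFinP; exact: measurable_funM.
move=> t _; rewrite -EFinM !abse_EFin lee_fin !normrM (ger0_norm (Q0 t)) mulrA.
by rewrite ler_wpM2r// -normrM (le_trans (GD t))// ler_norm.
Qed.

Let integral_KP N : (\int[mu]_t (K t * P N t)%:E = \int[mu]_t (K t)%:E)%E.
Proof.
rewrite -(@integral_round_fejer _ a a_gt0 n N (EFin \o @tuple_weight R n))//.
  by apply/measurable_EFinP; exact: measurable_tuple_weight.
by move=> t; rewrite lee_fin tuple_weight_ge0.
Qed.

Lemma integrable_fejer (G : n.-tuple RT -> R) D N : measurable_fun setT G ->
  (forall t, `|G t| <= D * K t) ->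
  mu.-integrable setT (fun t => (G t * P N t)%:E).
Proof.
move=> mG GD; apply: integrable_le_weight GD => //.
- exact: measurable_fejer_tuple.
- exact: fejer_tuple_ge0.
- by rewrite integral_KP; exact: integral_lattice_weight_lty.
Qed.

Lemma integrable_weight (G : n.-tuple RT -> R) D : measurable_fun setT G ->
  (forall t, `|G t| <= D * K t) ->
  mu.-integrable setT (fun t => (G t)%:E).
Proof.
move=> mG GD; rewrite (_ : (fun t => _) = (fun t => (G t * (cst 1 t))%:E)); last first.
  by apply/funext => t; rewrite mulr1.
apply: integrable_le_weight GD => //.
by under eq_integral do rewrite mulr1; exact: integral_lattice_weight_lty.
Qed.

Let mrd : measurable_fun setT rd := @measurable_round_tuple _ a a_gt0 n.
Let mFrd : measurable_fun setT (fun t => F (rd t)) := measurableT_comp mF mrd.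

Let integrable_decay : mu.-integrable setT (fun t => (F t)%:E).
Proof. exact: integrable_le_tuple_weight F_le. Qed.

Lemma integrable_decay_round : mu.-integrable setT (fun t => (F (rd t))%:E).
Proof. exact: integrable_weight Frd_leK. Qed.

Lemma integral_decay_round_fejer N :
  (\int[mu]_t (F (rd t) * P N t)%:E = \int[mu]_t (F (rd t))%:E)%E.
Proof.
(* The kernel is nonnegative, hence commutes with positive parts, and the nonnegative case applies.
   Negative parts are the positive parts of [- F]. *)
have pos (G : n.-tuple RT -> R) : measurable_fun setT G ->
  (\int[mu]_t (fun t => (G (rd t) * P N t)%:E)^\+ t =
   \int[mu]_t (fun t => (G (rd t))%:E)^\+ t)%E.
  move=> mG; pose H t := (Num.max (G t) 0)%:E.
  transitivity (\int[mu]_t (H (rd t) * (P N t)%:E))%E.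
    apply: eq_integral => t _; rewrite funeposE -EFin_max -EFinM.
    by rewrite maxr_pMl ?fejer_tuple_ge0// mul0r.
  rewrite integral_round_fejer//.
  - by apply: eq_integral => t _; rewrite funeposE -EFin_max.
  - by apply/measurable_EFinP; exact: measurable_maxr.
  - by move=> t; rewrite lee_fin le_max lexx orbT.
rewrite [LHS]integralE [RHS]integralE pos//; congr (_ - _)%E.
have := pos (fun t => - F t) (measurable_funN mF).
rewrite (_ : (fun t => (- F (rd t) * P N t)%:E) = (\- (fun t => (F (rd t) * P N t)%:E))%E); last first.
  by apply/funext => t; rewrite mulNr EFinN.
by rewrite !funeposN => ->; rewrite (_ : (fun t => _) = (\- (fun t => (F (rd t))%:E))%E) ?funeposN.
Qed.

Hypothesis F_lip : forall t, `|F t - F (rd t)| <=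
  L * (\sum_i `|(tnth t i : R) - round a (tnth t i)|) * K t.
(** Band limitation enters the limit argument only here; for Schwartz functions this is
    [integral_schwartz_fejer]. *)
Hypothesis F_fejer : forall N, (\int[mu]_t (F t * P N t)%:E = \int[mu]_t (F t)%:E)%E.
Hypothesis L_ge0 : 0 <= L.

Let I := fine (\int[mu]_t (K t)%:E).
Let I_ge0 : 0 <= I.
Proof. by apply: fine_ge0; apply: integral_ge0 => t _; rewrite lee_fin lattice_weight_ge0. Qed.
Let IE : (\int[mu]_t (K t)%:E = I%:E)%E.
Proof.
rewrite fineK// ge0_fin_numE ?integral_lattice_weight_lty//.
by apply: integral_ge0 => t _; rewrite lee_fin lattice_weight_ge0.
Qed.

(** Inserting [P N] in both integrals, the Lipschitz bound and [dist_round_sin] bound the difference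
    by two terms. The [e] term integrates to [L * n * e * I], and the sine term to at most
    [n * L * M * I / N.+1]. *)
Let diff_bound e : 0 < e ->
  (`|\int[mu]_t (F t)%:E - \int[mu]_t (F (rd t))%:E| <= (2 * L * n%:R * e * I)%:E)%E.
Proof.
move=> e0; have [M M0 HM] := dist_round_sin a_gt0 e0.
(* With [M / N.+1] at most [e], the sine term costs no more than the [e] term, whence the factor 2
   in the bound. *)
pose N := Num.trunc (M / e).
have NM : M / N.+1%:R <= e.
  by rewrite ler_pdivrMr// mulrC -ler_pdivrMr// ltW// truncnS_gt.
pose s (i : 'I_n) (t : n.-tuple RT) : R := sin (pi * (tnth t i : R) / a) ^+ 2.
have ms i : measurable_fun setT (s i).
  apply: measurable_funX; apply: measurableT_comp.
    exact: (continuous_measurable_fun (@continuous_sin R)).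
  apply: measurable_funM; last exact: measurable_cst.
  by apply: measurable_funM; [exact: measurable_cst|exact: (@measurable_tnth _ RT n i)].
have mP : measurable_fun setT (P N) by exact: measurable_fejer_tuple.
have mK := @measurable_lattice_weight _ a a_gt0 n.
have KP0 t : 0 <= K t * P N t by apply: mulr_ge0; [exact: lattice_weight_ge0|exact: fejer_tuple_ge0].
have KPs0 i t : 0 <= K t * (P N t * s i t).
  by rewrite mulrA; apply: mulr_ge0; [exact: KP0|exact: sqr_ge0].
have Lne0 : 0 <= L * n%:R * e by apply: mulr_ge0; [exact: mulr_ge0|exact: ltW].
have LM0 : 0 <= L * M by exact: mulr_ge0.
rewrite -(F_fejer N) -(integral_decay_round_fejer N).
have iF : mu.-integrable setT (fun t => (F t * P N t)%:E) := integrable_fejer N mF F_leK.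
have iFr : mu.-integrable setT (fun t => (F (rd t) * P N t)%:E) := integrable_fejer N mFrd Frd_leK.
rewrite -integralB//.
apply: le_trans (le_abse_integral _ _ _) _ => //.
  by case/integrableP: (integrableB measurableT iF iFr).
apply: (@le_trans _ _ (\int[mu]_t ((L * n%:R * e)%:E * (K t * P N t)%:E +
   \sum_(i < n) ((L * M)%:E * (K t * (P N t * s i t))%:E)))%E).
  apply: ge0_le_integral => //.
  - apply: measurableT_comp => //.
    by case/integrableP: (integrableB measurableT iF iFr).
  - apply: emeasurable_funD.
      by apply: measurable_funeM; apply/measurable_EFinP; exact: measurable_funM.
    apply: emeasurable_sum => i; apply: measurable_funeM; apply/measurable_EFinP.
    by apply: measurable_funM => //; exact: measurable_funM.
  - move=> t _; rewrite -EFinB abse_EFin -mulrBl normrM (ger0_norm (fejer_tuple_ge0 _ _ _)).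
    under eq_bigr do rewrite -EFinM.
    rewrite sumEFin -EFinM -EFinD lee_fin.
    apply: (@le_trans _ _ (L * (\sum_(i < n) (e + M * s i t)) * K t * P N t)).
      rewrite ler_wpM2r ?fejer_tuple_ge0//; apply: le_trans (F_lip t) _.
      rewrite ler_wpM2r ?lattice_weight_ge0// ler_wpM2l//.
      by apply: ler_sum => i _; exact: HM.
    rewrite big_split/= sumr_const card_ord -mulr_sumr -!mulr_sumr.
    by rewrite -[e *+ n]mulr_natl le_eqVlt; apply/orP; left; apply/eqP; ring.
rewrite ge0_integralD//; last 4 first.
- by move=> t _; rewrite -EFinM lee_fin; exact: mulr_ge0.
- by apply: measurable_funeM; apply/measurable_EFinP; exact: measurable_funM.
- by move=> t _; apply: sume_ge0 => i _; rewrite -EFinM lee_fin; exact: mulr_ge0.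
- apply: emeasurable_sum => i; apply: measurable_funeM; apply/measurable_EFinP.
  by apply: measurable_funM => //; exact: measurable_funM.
rewrite ge0_integral_sum//; last 2 first.
- move=> i; apply: measurable_funeM; apply/measurable_EFinP.
  by apply: measurable_funM => //; exact: measurable_funM.
- by move=> i t _; rewrite -EFinM lee_fin; exact: mulr_ge0.
apply: (@le_trans _ _ ((L * n%:R * e)%:E * I%:E + \sum_(i < n) ((L * M)%:E * (N.+1%:R^-1%:E * I%:E)))%E).
  apply: leeD.
    rewrite ge0_integralZl//.
    - by rewrite integral_KP IE.
    - by apply/measurable_EFinP; exact: measurable_funM.
    - by move=> t _; rewrite lee_fin.
  apply: lee_sum => i _; rewrite ge0_integralZl//.
  - rewrite lee_wpmul2l ?lee_fin ?mulr_ge0// -IE.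
    exact: integral_round_fejer_sin.
  - by apply/measurable_EFinP; apply: measurable_funM => //; exact: measurable_funM.
  - by move=> t _; rewrite lee_fin.
under eq_bigr do rewrite -!EFinM.
rewrite sumEFin -!EFinM -EFinD lee_fin sumr_const card_ord -[X in _ + X <= _]mulr_natl.
rewrite (_ : 2 * L * n%:R * e * I = L * n%:R * e * I + n%:R * (L * e * I)); last by ring.
rewrite lerD2l ler_wpM2l// (_ : L * M * (N.+1%:R^-1 * I) = L * (M / N.+1%:R) * I); last by ring.
by rewrite ler_wpM2r// ler_wpM2l.
Qed.

Lemma integral_round_eq : (\int[mu]_t (F (rd t))%:E = \int[mu]_t (F t)%:E)%E.
Proof.
have fF : (\int[mu]_t (F t)%:E)%E \is a fin_num := integrable_fin_num measurableT integrable_decay.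
have fFr : (\int[mu]_t (F (rd t))%:E)%E \is a fin_num := integrable_fin_num measurableT integrable_decay_round.
rewrite -(fineK fF) -(fineK fFr); congr EFin; apply/esym/eqP.
rewrite -subr_eq0 -normr_le0; apply/ler_addgt0Pr => e e0; rewrite add0r.
(* The added 1 keeps [B] positive, so that [diff_bound] can be used at [e / B]. *)
pose B := 2 * L * n%:R * I + 1.
have B0 : 0 < B by rewrite ltr_wpDl// !mulr_ge0.
have := diff_bound (divr_gt0 e0 B0).
rewrite -{1}(fineK fF) -{1}(fineK fFr) -EFinB abse_EFin lee_fin => /le_trans; apply.
rewrite (_ : _ * I = e * ((B - 1) / B)); last by rewrite /B; ring.
rewrite ger_pMr// ler_pdivrMr// mul1r; lra.
Qed.

End fejer_limit.

(** * Schwartz functions and Poisson summation *)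

Section schwartz_decay.
Context {R : realType}.
Notation RT := (measurableTypeR R).
Variable n : nat.
Implicit Types (f : 'rV[R]_n -> R) (x y : 'rV[R]_n).

(** The product of the [1 + x_i ^+ 2] expands into monomials with exponents 0 or 2, one for each
    [b], and each monomial times the derivative is bounded by the definition of the Schwartz
    class. *)
Lemma schwartz_decay f (s : seq 'I_n) : schwartz_real f ->
  exists2 C : R, 0 <= C & forall x, `|partials s f x| <= C * \prod_i weight (x ord0 i).
Proof.
move=> [_ dec].
have /choice[C HC] : forall b : {ffun 'I_n -> bool}, exists c : R, forall x,
    `|(\prod_i x ord0 i ^+ (b i).*2) * partials s f x| <= c.
  by move=> b; exact: dec.
have C0 b : 0 <= C b by exact: le_trans (normr_ge0 _) (HC b 0).
exists (\sum_b C b) => [|x]; first exact: sumr_ge0.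
have W0 : 0 < \prod_(i < n) oneDsqr (x ord0 i) by apply: prodr_gt0 => i _; exact: lt_le_trans ltr01 (oneDsqr_ge1 _).
have -> : \prod_i weight (x ord0 i) = (\prod_(i < n) oneDsqr (x ord0 i))^-1.
  by rewrite -prodfV.
rewrite ler_pdivlMr// mulrC /oneDsqr.
rewrite [X in X * _](_ : _ = \sum_(b : {ffun 'I_n -> bool}) \prod_i x ord0 i ^+ (b i).*2).
  rewrite mulr_suml; apply: ler_sum => b _.
  by apply: le_trans (HC b x); rewrite normrM ler_wpM2r// ler_norm.
transitivity (\prod_(i < n) \sum_(c : bool) x ord0 i ^+ (c : bool).*2).
  by apply: eq_bigr => i _; rewrite big_bool/= expr0 addrC.
by rewrite bigA_distr_bigA.
Qed.

Lemma lipschitz_1d (g dg : R -> R) (d M : R) :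
  (forall s : R, is_derive s 1 g (dg s)) ->
  (forall s, `|s| <= `|d| -> `|dg s| <= M) -> `|g d - g 0| <= M * `|d|.
Proof.
move=> gd dgM.
have cg A : {within A, continuous g}.
  by apply: continuous_subspaceT => t; have [/derivable1_diffP/differentiable_continuous] := gd t.
have [d0|d0] := leP 0 d.
  have [c] := MVT_segment d0 (fun s _ => gd s) (cg _).
  rewrite in_itv/= => /andP[c0 cd] ->; rewrite subr0 normrM ler_wpM2r//.
  by apply: dgM; rewrite !ger0_norm.
have [c] := MVT_segment (ltW d0) (fun s _ => gd s) (cg _).
rewrite in_itv/= => /andP[dc c0]; rewrite distrC => ->; rewrite sub0r normrM normrN ler_wpM2r//.
by apply: dgM; rewrite (ltr0_norm d0) ler0_norm// lerN2.
Qed.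

Lemma is_derive_line f (v z : 'rV[R]_n) (s : R) : derivable f (z + s *: v) v ->
  is_derive s 1 (fun r : R => f (z + r *: v)) ('D_v f (z + s *: v)).
Proof.
move=> df.
have E : (fun h : R => h^-1 *: (f (z + (h *: 1 + s) *: v) - f (z + s *: v))) =
   (fun h : R => h^-1 *: (f (h *: v + (z + s *: v)) - f (z + s *: v))).
  apply/funext => h; congr (_ *: (f _ - _)).
  by rewrite scalerDl -[h *: 1]/(h * 1) mulr1 addrCA.
apply: DeriveDef.
  by rewrite /derivable /shift/= /comp; rewrite E.
by rewrite /derive /shift/= /comp E.
Qed.

(** The coordinates of [x] are replaced by those of [y] one at a time, so that each increment is
    governed by a single partial derivative. All points met lie within [r] of [y] in each
    coordinate, and [weight_near] moves the decay to [y] at the price of the factor [c]. *)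
Lemma schwartz_lipschitz f (r : R) : 0 <= r -> schwartz_real f ->
  exists2 L : R, 0 <= L & forall x y, (forall i, `|x ord0 i - y ord0 i| <= r) ->
    `|f x - f y| <= L * (\sum_i `|x ord0 i - y ord0 i|) * \prod_i weight (y ord0 i).
Proof.
move=> r0 sf; have [sm _] := sf.
have /choice[C HC] : forall i : 'I_n, exists c : R, 0 <= c /\ forall x,
    `|'D_(delta_mx ord0 i) f x| <= c * \prod_i weight (x ord0 i).
  by move=> i; have [c c0 H] := schwartz_decay [:: i] sf; exists c.
pose c := (2 + 2 * r ^+ 2) ^+ n.
have c0 : 0 <= c by rewrite exprn_ge0// addr_ge0// mulr_ge0 ?sqr_ge0.
have C0 i : 0 <= C i by have [] := HC i.
exists (c * \sum_i C i) => [|x y xy]; first by rewrite mulr_ge0// sumr_ge0.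
(* The coordinates of index below [k] come from [y], the others from [x]. *)
pose z (k : nat) : 'rV[R]_n := \row_i (if (i < k)%N then y ord0 i else x ord0 i).
have z0 : z 0%N = x by apply/rowP => i; rewrite mxE.
have zn : z n = y by apply/rowP => i; rewrite mxE ltn_ord.
have zS (k : 'I_n) : z k = z k.+1 + (x ord0 k - y ord0 k) *: delta_mx ord0 k.
  apply/rowP => i; rewrite !mxE eqxx/=; have [->|ik] := eqVneq i k.
    by rewrite ltnn ltnSn mulr1 addrC subrK.
  by rewrite mulr0 addr0 ltnS [(i <= k)%N]leq_eqVlt (negbTE (ik : i != k :> nat)).
have -> : f x - f y = \sum_(k < n) (f (z k) - f (z k.+1)).
  rewrite -(big_mkord xpredT (fun k => f (z k) - f (z k.+1))).
  under eq_bigr do rewrite -opprB.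
  by rewrite sumrN telescope_sumr// opprB z0 zn.
apply: le_trans (ler_norm_sum _ _ _) _.
rewrite mulrAC mulr_sumr; apply: ler_sum => k _.
have HCk : C k <= \sum_i C i by rewrite (bigD1 k)//= lerDl sumr_ge0.
have W0 : 0 <= \prod_i weight (y ord0 i) by apply: prodr_ge0 => i _; exact: weight_ge0.
pose g (s : R) := f (z k.+1 + s *: delta_mx ord0 k).
have -> : f (z k) - f (z k.+1) = g (x ord0 k - y ord0 k) - g 0.
  by rewrite /g -zS scale0r addr0.
apply: (@lipschitz_1d g (fun s => 'D_(delta_mx ord0 k) f (z k.+1 + s *: delta_mx ord0 k))).
  by move=> s; apply: is_derive_line; have [_] := sm [::]; exact.
move=> s sd; have [_ H] := HC k; apply: le_trans (H _) _.
rewrite -mulrA mulrCA.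
apply: ler_pM => //; first by apply: prodr_ge0 => i _; exact: weight_ge0.
rewrite /c -[X in _ ^+ X](card_ord n) -prodr_const -big_split/=.
apply: ler_prod => i _; rewrite weight_ge0; apply: weight_near.
rewrite !mxE eqxx/=; case: (eqVneq i k) => [->|ik].
  by rewrite ltnSn mulr1 addrAC subrr add0r (le_trans sd).
rewrite mulr0 addr0; case: ifP => _ //; by rewrite subrr normr0.
Qed.

End schwartz_decay.

(** * Expansion of the product of Fejer kernels in cosines *)

Section fejer_expansion.
Context {R : realType} (a : R).
Hypothesis a_gt0 : 0 < a.
Notation RT := (measurableTypeR R).
Variable n : nat.

Lemma Re_sum I (r : seq I) (P : pred I) (z : I -> R[i]) :
  complex.Re (\sum_(i <- r | P i) z i) = \sum_(i <- r | P i) complex.Re (z i).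
Proof. by apply: (big_morph (@complex.Re R)) => // -[? ?] [? ?]. Qed.

Lemma Im_sum I (r : seq I) (P : pred I) (z : I -> R[i]) :
  complex.Im (\sum_(i <- r | P i) z i) = \sum_(i <- r | P i) complex.Im (z i).
Proof. by apply: (big_morph (@complex.Im R)) => // -[? ?] [? ?]. Qed.

Lemma Re_realM (c : R) (z : R[i]) : complex.Re (c%:C%C * z) = c * complex.Re z.
Proof. by case: z => x y /=; rewrite mul0r subr0. Qed.

Lemma Im_realM (c : R) (z : R[i]) : complex.Im (c%:C%C * z) = c * complex.Im z.
Proof. by case: z => x y /=; rewrite mul0r addr0. Qed.

Lemma cexpiD (x y : R) : cexpi (x + y) = cexpi x * cexpi y.
Proof.
rewrite /cexpi cosD sinD; apply/eqP; rewrite eq_complex /=; apply/andP.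
by split; apply/eqP; ring.
Qed.

Lemma cexpi_sum I (r : seq I) (x : I -> R) :
  cexpi (\sum_(i <- r) x i) = \prod_(i <- r) cexpi (x i).
Proof.
apply: (big_morph (@cexpi R)); first exact: cexpiD.
by rewrite /cexpi cos0 sin0.
Qed.

Definition freq N (p : 'I_N.+1 * 'I_N.+1) : int := p.1%:Z - p.2%:Z.

(** Exponentials are wanted because a product of them is again an exponential, which lets the
    product over coordinates expand into single phases. *)
Lemma fejer_cexpi N (t : R) : (fejer a N t)%:C%C =
  (N.+1%:R^-1)%:C%C * \sum_(p : 'I_N.+1 * 'I_N.+1) cexpi (2 * pi * (freq p)%:~R * t / a).
Proof.
apply/eqP; rewrite eq_complex Re_realM Im_realM Re_sum Im_sum /=.
apply/andP; split; apply/eqP.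
  by rewrite /fejer pair_bigA.
apply/esym; rewrite -[RHS](mulr0 (N.+1%:R^-1)); congr (_ * _).
set S := \sum_p _.
(* Exchanging the two entries of [p] negates its frequency, so the sum of sines is its own
   opposite. *)
have SN : S = - S.
  rewrite {1}/S (reindex (fun p : 'I_N.+1 * 'I_N.+1 => (p.2, p.1)))/=; last first.
    by exists (fun p => (p.2, p.1)) => -[].
  rewrite /S -sumrN; apply: eq_bigr => p _; rewrite -sinN; congr sin.
  by rewrite /freq /= -opprB rmorphN/= mulrN !mulNr.
by lra.
Qed.

Lemma fejer_tupleE N (t : n.-tuple RT) : fejer_tuple a N t =
  N.+1%:R^-1 ^+ n * \sum_(p : {ffun 'I_n -> 'I_N.+1 * 'I_N.+1})
    cos (2 * pi * \sum_i ((freq (p i))%:~R / a) * tnth t i).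
Proof.
rewrite -[LHS]/(complex.Re (fejer_tuple a N t)%:C%C) /fejer_tuple rmorph_prod/=.
under eq_bigr do rewrite fejer_cexpi.
rewrite big_split/= prodr_const card_ord -rmorphXn/= Re_realM; congr (_ * _).
rewrite bigA_distr_bigA Re_sum; apply: eq_bigr => p _.
rewrite -cexpi_sum /=; congr cos; rewrite mulr_sumr; apply: eq_bigr => i _.
by ring.
Qed.

(** In each coordinate exactly the [N.+1] diagonal pairs have frequency zero. *)
Lemma card_zero_freq N :
  \sum_(p : {ffun 'I_n -> 'I_N.+1 * 'I_N.+1}) \prod_i (freq (p i) == 0)%:R = N.+1%:R ^+ n :> R.
Proof.
rewrite -(bigA_distr_bigA (fun _ q => (freq q == 0)%:R)).
rewrite -[in RHS](card_ord n) -prodr_const; apply: eq_bigr => i _.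
rewrite -(pair_bigA _ (fun j l : 'I_N.+1 => (freq (j, l) == 0)%:R))/=.
under eq_bigr => j _.
  rewrite (bigD1 j)//= /freq/= subrr eqxx big1 ?addr0; last first.
    by move=> l lj; rewrite subr_eq0 eqz_nat (_ : (j == l :> nat) = false)// eq_sym; apply/negbTE.
  over.
by rewrite sumr_const card_ord.
Qed.

End fejer_expansion.

Section bandlimited.
Context {R : realType} (a : R).
Hypothesis a_gt0 : 0 < a.
Notation RT := (measurableTypeR R).
Variable n : nat.
Notation mu := (@lebesgue_tuple R n).

Variable eta : 'rV[R]_n -> R[i].
Hypothesis eta_schwartz : schwartz eta.
Hypothesis eta_supp : support_Rn (fourier eta) `<=` cube (1 / (2 * a)).

(** Nonvanishing at this point would place it in the support, so that every [m i] would be at most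
    1/2 in modulus, hence zero. *)
Lemma fourier_outside (m : 'I_n -> int) : ~~ [forall i, m i == 0] ->
  fourier eta (\row_i ((m i)%:~R / a)) = 0.
Proof.
move=> m0; apply/eqP; apply: contraNT m0 => e0; apply/forallP => i.
have /eta_supp : support_Rn (fourier eta) (\row_i ((m i)%:~R / a)) by exact: subset_closure.
move=> /(_ i); rewrite mxE -ler_norml normrM normfV (gtr0_norm a_gt0).
rewrite ler_pdivrMr// -intr_norm => h.
have : (`|m i|%:~R : R) < 1%:~R.
  by rewrite (le_lt_trans h)// mul1r invfM mulfVK ?gt_eqF//; lra.
by rewrite ltr_int; case: (m i) => [[|k]|k].
Qed.

Lemma measurable_schwartz (f : 'rV[R]_n -> R) : schwartz_real f ->
  measurable_fun setT (fun t : n.-tuple RT => f (rV_of_tuple t)).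
Proof. by move=> [/(_ [::])[cf _] _]; exact: continuous_measurable_rV. Qed.

Lemma schwartz_le_weight (f : 'rV[R]_n -> R) : schwartz_real f ->
  exists C : R, forall t : n.-tuple RT, `|f (rV_of_tuple t)| <= C * tuple_weight t.
Proof.
move=> /(schwartz_decay [::])[C _ HC]; exists C => t; apply: le_trans (HC _) _.
rewrite le_eqVlt; apply/orP; left; apply/eqP; congr (_ * _).
by apply: eq_bigr => i _; rewrite mxE.
Qed.

Lemma integrable_schwartz_bounded (f : 'rV[R]_n -> R) (g : n.-tuple RT -> R) :
  schwartz_real f -> measurable_fun setT g -> (forall t, `|g t| <= 1) ->
  mu.-integrable setT (fun t => (f (rV_of_tuple t) * g t)%:E).
Proof.
move=> sf mg g1; have [C HC] := schwartz_le_weight sf.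
apply: (@integrable_le_tuple_weight _ n _ C).
  by apply: measurable_funM => //; exact: measurable_schwartz.
by move=> t; rewrite normrM (le_trans _ (HC t))// ler_piMr.
Qed.

Definition phase (m : 'I_n -> int) (t : n.-tuple RT) : R :=
  2 * pi * \sum_i ((m i)%:~R / a) * tnth t i.

Lemma measurable_phase m : measurable_fun setT (phase m).
Proof.
apply: measurable_funM; first exact: measurable_cst.
apply: measurable_sum => i; apply: measurable_funM; first exact: measurable_cst.
exact: (@measurable_tnth _ RT n i).
Qed.

Lemma measurable_cos_phase m : measurable_fun setT (fun t => cos (phase m t)).
Proof.
by apply: measurableT_comp (measurable_phase m); exact: (continuous_measurable_fun (@continuous_cos R)).
Qed.

Lemma measurable_sin_phase m : measurable_fun setT (fun t => sin (phase m t)).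
Proof.
by apply: measurableT_comp (measurable_phase m); exact: (continuous_measurable_fun (@continuous_sin R)).
Qed.

Lemma norm_cos (x : R) : `|cos x| <= 1.
Proof. by rewrite ler_norml cos_geN1 cos_le1. Qed.

Lemma norm_sin (x : R) : `|sin x| <= 1.
Proof. by rewrite ler_norml sin_geN1 sin_le1. Qed.

Let fR (x : 'rV[R]_n) := complex.Re (eta x).
Let fI (x : 'rV[R]_n) := complex.Im (eta x).
Let sR : schwartz_real fR := eta_schwartz.1.
Let sI : schwartz_real fI := eta_schwartz.2.

Notation Rint f g := (\int[mu]_t (f (rV_of_tuple t) * g t)).

Lemma fourier_phase m :
  fourier eta (\row_i ((m i)%:~R / a)) =
  ((Rint fR (fun t => cos (phase m t)) + Rint fI (fun t => sin (phase m t))) +i*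
   (Rint fI (fun t => cos (phase m t)) - Rint fR (fun t => sin (phase m t))))%C.
Proof.
have E (t : n.-tuple RT) : - (2 * pi * dotv (rV_of_tuple t) (\row_i ((m i)%:~R / a))) = - phase m t.
  by congr (- (_ * _)); apply: eq_bigr => i _; rewrite !mxE mulrC.
have iRc := integrable_schwartz_bounded sR (measurable_cos_phase m) (fun t => norm_cos _).
have iRs := integrable_schwartz_bounded sR (measurable_sin_phase m) (fun t => norm_sin _).
have iIc := integrable_schwartz_bounded sI (measurable_cos_phase m) (fun t => norm_cos _).
have iIs := integrable_schwartz_bounded sI (measurable_sin_phase m) (fun t => norm_sin _).
rewrite /fourier /cintegral_Rn /integral_Rn; congr (_ +i* _)%C.
  rewrite -RintegralD//; apply: eq_Rintegral => t _.
  by rewrite /fR /fI E /cexpi cosN sinN; case: (eta _) => x y /=; ring.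
rewrite -RintegralB//; apply: eq_Rintegral => t _.
by rewrite /fR /fI E /cexpi cosN sinN; case: (eta _) => x y /=; ring.
Qed.

(** As [eta] is complex, the equation at [m] mixes the cosine integral of one part with the sine
    integral of the other. The equation at [-m] has the opposite sine terms, and adding the two
    isolates the cosine integrals. *)
Lemma integral_cos_phase m : ~~ [forall i, m i == 0] ->
  Rint fR (fun t => cos (phase m t)) = 0 /\ Rint fI (fun t => cos (phase m t)) = 0.
Proof.
move=> m0; have := fourier_outside m0; rewrite fourier_phase => /eqP.
have m0N : ~~ [forall i, (fun i => - m i) i == 0].
  by apply: contra m0 => /forallP h; apply/forallP => i; have := h i; rewrite oppr_eq0.
have := fourier_outside m0N; rewrite fourier_phase => /eqP.
have pN t : phase (fun i => - m i) t = - phase m t.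
  rewrite /phase -mulrN -sumrN; congr (_ * _); apply: eq_bigr => i _.
  by rewrite rmorphN/= !mulNr.
have cN f : Rint f (fun t => cos (phase (fun i => - m i) t)) = Rint f (fun t => cos (phase m t)).
  by apply: eq_Rintegral => t _; rewrite pN cosN.
have sN f : schwartz_real f -> Rint f (fun t => sin (phase (fun i => - m i) t)) = - Rint f (fun t => sin (phase m t)).
  move=> sf; rewrite -mulN1r -RintegralZl//.
    by apply: eq_Rintegral => t _; rewrite pN sinN; ring.
  exact: integrable_schwartz_bounded (measurable_sin_phase m) (fun t => norm_sin _).
rewrite !cN !sN// !eq_complex/= => /andP[/eqP h1 /eqP h2] /andP[/eqP h3 /eqP h4].
by split; lra.
Qed.

(** Only the terms with all frequencies zero survive; by [card_zero_freq] their number is the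
    inverse of the normalizing factor. *)
Lemma integral_schwartz_fejer f N : f = fR \/ f = fI ->
  (\int[mu]_t (f (rV_of_tuple t) * fejer_tuple a N t)%:E =
   \int[mu]_t (f (rV_of_tuple t))%:E)%E.
Proof.
move=> fE.
have sf : schwartz_real f by case: fE => ->.
have ic m := integrable_schwartz_bounded sf (measurable_cos_phase m) (fun t => norm_cos _).
have i1 : mu.-integrable setT (fun t => (f (rV_of_tuple t))%:E).
  have [C HC] := schwartz_le_weight sf.
  by apply: (@integrable_le_tuple_weight _ n _ C) => //; exact: measurable_schwartz.
pose m (p : {ffun 'I_n -> 'I_N.+1 * 'I_N.+1}) i := freq (p i).
pose J := \int[mu]_t f (rV_of_tuple t).
have JE : (\int[mu]_t (f (rV_of_tuple t))%:E = J%:E)%E.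
  by rewrite fineK//; exact: integrable_fin_num.
have cJ p : (\int[mu]_t (f (rV_of_tuple t) * cos (phase (m p) t))%:E =
    ((\prod_i (freq (p i) == 0)%:R) * J)%:E)%E.
  have [/forallP z|z] := boolP [forall i, m p i == 0].
    rewrite big1 => [|i _]; last by rewrite (z i).
    rewrite mul1r -JE; apply: eq_integral => t _; congr EFin.
    rewrite /phase big1 ?mulr0 ?cos0 ?mulr1// => i _.
    by rewrite (eqP (z i)) !mul0r.
  rewrite -[LHS]fineK; last by apply: integrable_fin_num => //; exact: ic.
  congr EFin; transitivity (0 : R).
    by have [h1 h2] := integral_cos_phase z; case: fE => ->.
  have [i /negbTE zi] : exists i, m p i != 0 by apply/existsP; rewrite -negb_forall.
  by rewrite (bigD1 i)//= -/(m p i) zi !mul0r.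
transitivity (\int[mu]_t \sum_(p : {ffun 'I_n -> 'I_N.+1 * 'I_N.+1})
    ((N.+1%:R^-1 ^+ n)%:E * (f (rV_of_tuple t) * cos (phase (m p) t))%:E))%E.
  apply: eq_integral => t _; rewrite fejer_tupleE mulrCA.
  by rewrite mulr_sumr mulr_sumr -sumEFin; under eq_bigr do rewrite EFinM.
rewrite integral_sum//; last by move=> p; exact: integrableZl.
under eq_bigr do rewrite integralZl// cJ -EFinM.
rewrite sumEFin -mulr_sumr -mulr_suml card_zero_freq mulrA -exprMn mulVf//.
by rewrite expr1n mul1r JE.
Qed.

End bandlimited.

Section poisson_summation.
Context {R : realType} (a : R).
Hypothesis a_gt0 : 0 < a.
Notation RT := (measurableTypeR R).
Variable n : nat.
Notation mu := (@lebesgue_tuple R n).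

Lemma integrable_schwartz (f : 'rV[R]_n -> R) : schwartz_real f ->
  mu.-integrable setT (fun t => (f (rV_of_tuple t))%:E).
Proof.
move=> sf; have [C HC] := schwartz_le_weight sf.
by apply: (@integrable_le_tuple_weight _ n _ C) => //; exact: measurable_schwartz.
Qed.

Lemma integrable_schwartz_round (f : 'rV[R]_n -> R) : schwartz_real f ->
  mu.-integrable setT (fun t => (f (rV_of_tuple (round_tuple a t)))%:E).
Proof.
move=> sf; have [C HC] := schwartz_le_weight sf.
apply: (@integrable_decay_round _ a a_gt0 n (fun t => f (rV_of_tuple t)) C) => //.
exact: measurable_schwartz.
Qed.

(* [\int f (round x) dx] is [a ^ n] times the sum of [f] over the lattice. *)
Lemma poisson_summation (eta : 'rV[R]_n -> R[i]) (f : 'rV[R]_n -> R) :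
  schwartz eta -> support_Rn (fourier eta) `<=` cube (1 / (2 * a)) ->
  f = (fun x => complex.Re (eta x)) \/ f = (fun x => complex.Im (eta x)) ->
  (\int[mu]_t (f (rV_of_tuple (round_tuple a t)))%:E =
   \int[mu]_t (f (rV_of_tuple t))%:E)%E.
Proof.
move=> se supp fE.
have sf : schwartz_real f by case: fE => ->; case: se.
have [C HC] := schwartz_le_weight sf.
have [||L L0 HL] := @schwartz_lipschitz R n f (a / 2); [by rewrite divr_ge0// ltW|by []|].
apply: (@integral_round_eq _ a a_gt0 n (fun t => f (rV_of_tuple t)) C L) => //.
- exact: measurable_schwartz.
- move=> t; have := HL (rV_of_tuple t) (rV_of_tuple (round_tuple a t)).
  move=> /(_ _)/le_trans; apply.
    by move=> i; rewrite !mxE tnth_map; exact: dist_round.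
  rewrite le_eqVlt; apply/orP; left; apply/eqP; congr (_ * _ * _).
    by apply: eq_bigr => i _; rewrite !mxE tnth_map.
  by apply: eq_bigr => i _; rewrite mxE.
- move=> N; exact: (integral_schwartz_fejer a_gt0 se supp).
Qed.

End poisson_summation.

(** * Tuples of points with distinct labels *)

Section distinct_measure.
Context {R : realType}.
Notation RT := (measurableTypeR R).
Variable n : nat.
Implicit Types (u : configuration R) (j : {ffun 'I_n -> nat}).

Definition point_tuple u j : n.-tuple RT := [tuple Defs.point u (j i) | i < n].

Let enum_ffun (k : nat) : {ffun 'I_n -> nat} := odflt [ffun=> 0%N] (pickle_inv k).

Let enum_set u : set nat :=
  [set k | exists2 j, distinct_tuples u j & (pickle_inv k : option {ffun 'I_n -> nat}) = Some j].

Let enum_image u : enum_ffun @` enum_set u = distinct_tuples u.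
Proof.
apply/seteqP; split => [_ [k [j Dj jE]] <-|j Dj]; first by rewrite /enum_ffun jE.
have [k kE] : exists k, (pickle_inv k : option {ffun 'I_n -> nat}) = Some j.
  by eexists; exact: pickleK_inv.
by exists k; [exists j|rewrite /enum_ffun kE].
Qed.

Let enum_inj u : set_inj (enum_set u) enum_ffun.
Proof.
move=> k l; rewrite !inE => -[j _ jE] [i _ iE]; rewrite /enum_ffun jE iE /= => ij.
have := @pickle_invK {ffun 'I_n -> nat} k; rewrite jE /= => <-.
by have := @pickle_invK {ffun 'I_n -> nat} l; rewrite iE /= => <-; rewrite ij.
Qed.

(* The sum of the Dirac masses at the tuples is indexed by the codes of the
   tuples of labels, as [mseries] is a series over [nat]. *)
Let enum_dirac u (k : nat) : {measure set (n.-tuple RT) -> \bar R} :=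
  if k \in enum_set u
  then (dirac (point_tuple u (enum_ffun k)) : {measure set (n.-tuple RT) -> \bar R})
  else (mzero : {measure set (n.-tuple RT) -> \bar R}).

(** The [n]-th factorial power of the point measure of [u]. *)
Definition distinct_measure u : {measure set (n.-tuple RT) -> \bar R} :=
  mseries (enum_dirac u) 0.

Lemma integral_distinct_measure u (f : n.-tuple RT -> \bar R) :
  measurable_fun setT f -> (forall t, 0 <= f t)%E ->
  (\int[distinct_measure u]_t f t =
   \esum_(j in distinct_tuples u) f (point_tuple u j))%E.
Proof.
move=> mf f0; rewrite ge0_integral_measure_series//.
have ei : set_inj (enum_set u) enum_ffun by exact: enum_inj.
rewrite -enum_image (esum_set_image _ _ _ _ ei); last by move=> k _; exact: f0.

rewrite [RHS]eseries_mkcond; apply: eq_eseriesr => k _.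
rewrite /enum_dirac; case: ifPn => _; last by rewrite integral_measure_zero.
by rewrite integral_dirac// diracT mul1e.
Qed.

Lemma distinct_measureE u (A : set (n.-tuple RT)) : measurable A ->
  (distinct_measure u A =
   \esum_(j in distinct_tuples u) (\1_A (point_tuple u j))%:E)%E.
Proof.
move=> mA; rewrite -(@integral_distinct_measure u (fun t => (\1_A t)%:E))//.
- by rewrite integral_indic// setIT.
- by apply/measurable_EFinP.
Qed.

Lemma row_point_tuple u j : \row_i Defs.point u (j i) = rV_of_tuple (point_tuple u j).
Proof. by apply/rowP => i; rewrite !mxE tnth_mktuple. Qed.

End distinct_measure.

(** * Inclusion-exclusion for counts of tuples with distinct labels *)

Section uniq_sums.
Context {R : comPzRingType} {T : finType}.

Definition uniq_sum n (g : 'I_n -> T -> R) : R :=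
  \sum_(t : n.-tuple T | uniq t) \prod_i g i (tnth t i).

Lemma uniq_sum0 (g : 'I_0 -> T -> R) : uniq_sum g = 1.
Proof.
rewrite /uniq_sum (big_pred1 [tuple]) ?big_ord0// => t.
by rewrite tuple0; apply/esym/eqP.
Qed.

(* Summing over the first entry [x] of a repetition-free tuple [x :: t] gives
   the unrestricted sum minus the terms with [x = tnth t i]. *)
Lemma uniq_sumS n (g : 'I_n.+1 -> T -> R) :
  uniq_sum g = (\sum_x g ord0 x) * uniq_sum (fun i => g (lift ord0 i)) -
    \sum_(i < n) uniq_sum (fun k x => (if k == i then g ord0 x else 1) * g (lift ord0 k) x).
Proof.
pose cons (p : T * n.-tuple T) : n.+1.-tuple T := [tuple of p.1 :: p.2].
rewrite {1}/uniq_sum (reindex cons)/=; last first.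
  exists (fun t => (thead t, [tuple of behead t])) => [[x t] _|t _].
    by rewrite /= theadE; congr (_, _); exact: val_inj.
  by rewrite [RHS]tuple_eta; exact: val_inj.
rewrite big_mkcond -(pair_bigA _ (fun x (t : n.-tuple T) => if (x \notin t) && uniq t then
  \prod_i g i (tnth (cons (x, t)) i) else 0))/= exchange_big/=.
rewrite /uniq_sum [X in _ - X]exchange_big/= mulr_sumr -sumrB [RHS]big_mkcond/=.
apply: eq_bigr => t _; case: ifPn => [ut|ut]; last first.
  by rewrite big1// => x _; rewrite andbF.
under eq_bigr do rewrite andbT.
rewrite -big_mkcond/=.
transitivity ((\sum_(x | x \notin t) g ord0 x) * \prod_(i < n) g (lift ord0 i) (tnth t i)).
  rewrite mulr_suml; apply: eq_bigr => x _; rewrite big_ord_recl/=; congr (_ * _).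
  by apply: eq_bigr => i _; rewrite tnthS.
have -> : \sum_x g ord0 x = \sum_(x | x \notin t) g ord0 x + \sum_(i < n) g ord0 (tnth t i).
  rewrite (bigID (fun x => x \in t))/= addrC; congr (_ + _).
  by rewrite -big_uniq// big_tuple.
rewrite mulrDl -addrA -[LHS]addr0; congr (_ + _).
apply/esym/eqP; rewrite subr_eq0 mulr_suml; apply/eqP/eq_bigr => i _.
rewrite big_split/=; congr (_ * _).
by rewrite (bigD1 i)//= eqxx big1 ?mulr1// => k /negbTE ->.
Qed.

End uniq_sums.

Section box_counts.
Context {R : realType}.
Notation RT := (measurableTypeR R).
Implicit Types (u : configuration R) (V : set R).

Definition box_count n (V : 'I_n -> set R) u : \bar R :=
  \esum_(j in @distinct_tuples R n u) (\prod_i \1_(V i) (Defs.point u (j i)))%:E.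

Lemma enum_labels u K : bounded_set K -> exists2 s : seq nat, uniq s &
  forall l, l \in s <-> labels u l /\ K (Defs.point u l).
Proof.
move=> bK; have fK := locally_finite u bK.
exists (enum_fset (fset_set [set j | labels u j /\ K (Defs.point u j)])).
  exact: fset_uniq.
by move=> l; rewrite in_fset_set// inE.
Qed.

Section enumerated.
Variables (u : configuration R) (K : set R) (s : seq nat).
Hypothesis us : uniq s.
Hypothesis sP : forall l, l \in s <-> labels u l /\ K (Defs.point u l).

Let e (x : 'I_(size s)) : nat := tnth (in_tuple s) x.

Let e_inj : injective e.
Proof. exact/(tuple_uniqP (in_tuple s)). Qed.

(** All the sets lie in [K], so only the finitely many labels listed in [s] contribute and the
    series is a finite sum. *)
Lemma box_count_uniq_sum n (V : 'I_n -> set R) : (forall i, V i `<=` K) ->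
  box_count V u = (uniq_sum (fun i x => \1_(V i) (Defs.point u (e x)) : R))%:E.
Proof.
move=> VK.
pose h (t : n.-tuple 'I_(size s)) : {ffun 'I_n -> nat} := [ffun i => e (tnth t i)].
have h_inj : injective h.
  move=> t t' tt'; apply: eq_from_tnth => i; apply: e_inj.
  by have := congr1 (fun f : {ffun 'I_n -> nat} => f i) tt'; rewrite !ffunE.
pose r := [seq h t | t <- enum [pred t : n.-tuple 'I_(size s) | uniq t]].
transitivity (\esum_(j in [set` r]) (\prod_i \1_(V i) (Defs.point u (j i)))%:E : \bar R)%E; last first.
  rewrite esum_fset; [|exact: finite_seq|by move=> j _; rewrite lee_fin prodr_ge0].
  rewrite -fsbig_seq ?map_inj_uniq ?enum_uniq// big_map big_enum/= /uniq_sum -sumEFin.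
  by apply: eq_bigr => t _; congr EFin; apply: eq_bigr => i _; rewrite ffunE.
(* Every tuple of [r] has distinct labels. A tuple of distinct labels missing from [r] has a label
   outside [s], hence a point outside some [V i], and its term is zero. *)
rewrite /box_count esum_mkcond [RHS]esum_mkcond; apply: eq_esum => j _.
case: ifPn; rewrite ?inE ?notin_setE/= => Dj; last first.
  case: ifPn => //; rewrite inE/= => /mapP[t]; rewrite mem_enum inE => ut jE; exfalso.
  apply: Dj; split => [i k|i]; rewrite jE !ffunE.
    by move=> /e_inj tik; apply: (tuple_uniqP _ ut).
  have := mem_tnth (tnth t i) (in_tuple s).
  by move=> /sP[].
case: ifPn => //; rewrite notin_setE/= => jr.
have [/forallP VP|] := boolP [forall i, `[< V i (Defs.point u (j i)) >] ].
  exfalso; apply: jr.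
  have js i : j i \in s.
    by apply/sP; split; [exact: Dj.2|apply: (VK i); exact/asboolP].
  have ji i : (index (j i) s < size s)%N by rewrite index_mem.
  apply/mapP; exists [tuple Ordinal (ji i) | i < n].
    rewrite mem_enum inE; apply/tuple_uniqP => i k; rewrite !tnth_mktuple => -[] /(congr1 (nth 0%N s)).
    by rewrite !nth_index//; exact: Dj.1.
  apply/ffunP => i; rewrite ffunE /e tnth_mktuple (tnth_nth 0%N)/=.
  by rewrite nth_index.
rewrite negb_forall => /existsP[i /asboolPn nV]; congr EFin.
by rewrite (bigD1 i)//= indicE memNset// mul0r.
Qed.

Lemma npoints_sum V : V `<=` K ->
  npoints V u = (\sum_x \1_V (Defs.point u (e x)) : R)%:E.
Proof.
move=> VK.
have E : [set j | labels u j /\ V (Defs.point u j)] =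
    [set` [seq l <- s | `[< V (Defs.point u l) >]]].
  apply/seteqP; split => l /=.
    by move=> [ll Vl]; rewrite mem_filter; apply/andP; split; [exact/asboolP|apply/sP; split => //; exact: VK].
  by rewrite mem_filter => /andP[/asboolP Vl /sP[]].
rewrite /npoints E /counting asboolT; [congr EFin|exact: finite_seq].
transitivity (\sum_(l <- fset_set [set` [seq l <- s | `[< V (Defs.point u l) >]]]) (1 : R)).
  by rewrite big_const_seq count_predT iter_addr_0.
rewrite -fsbig_finite; last exact: finite_seq.
rewrite -fsbig_seq ?filter_uniq// big_filter big_mkcond/=.
rewrite -[X in \sum_(i <- X) _](in_tupleE s) big_tuple/=; apply: eq_bigr => x _.
by rewrite indicE /e; case: asboolP => [Vx|nVx]; [rewrite mem_set|rewrite memNset].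
Qed.

End enumerated.

End box_counts.

Section box_count_measurable.
Context {R : realType}.
Notation RT := (measurableTypeR R).
Implicit Types (u : configuration R) (V : set R).

Lemma box_count_fin n (V : 'I_n -> set R) u K : bounded_set K ->
  (forall i, V i `<=` K) -> box_count V u \is a fin_num.
Proof.
move=> bK VK; have [s us sP] := enum_labels u bK.
by rewrite (box_count_uniq_sum us sP VK).
Qed.

Lemma npoints_nat V u : bounded_set V -> exists m : nat, npoints V u = m%:R%:E.
Proof.
move=> bV; have fV := locally_finite u bV.
by rewrite /npoints /counting asboolT//; eexists.
Qed.

Lemma box_count0 (V : 'I_0 -> set R) u : box_count V u = 1%E.
Proof.
have bK : bounded_set (set0 : set R) by exists 0; split => // x _ y.
have [s us sP] := enum_labels u bK.
have V0 i : V i `<=` set0 by case: i.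
by rewrite (box_count_uniq_sum us sP V0) uniq_sum0.
Qed.

(** Instance of [uniq_sumS]: a product of two indicators at one point is the indicator of the
    intersection. Counts of [n.+1] sets thus reduce to counts of [n] sets and [npoints], all finite
    since the sets are bounded. *)
Lemma box_countS n (V : 'I_n.+1 -> set R) u K : bounded_set K ->
  (forall i, V i `<=` K) ->
  box_count V u = (fine (npoints (V ord0) u) * fine (box_count (fun i => V (lift ord0 i)) u) -
    \sum_(i < n) fine (box_count (fun k =>
      if k == i then V ord0 `&` V (lift ord0 k) else V (lift ord0 k)) u))%:E.
Proof.
move=> bK VK; have [s us sP] := enum_labels u bK.
rewrite (box_count_uniq_sum us sP VK) uniq_sumS; congr (EFin (_ * _ - _)).
- by rewrite (npoints_sum us sP (VK ord0)).
- by rewrite (box_count_uniq_sum us sP (fun i => VK (lift ord0 i))).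
- apply: eq_bigr => i _; rewrite (box_count_uniq_sum us sP)/=.
    apply: eq_bigr => t _; apply: eq_bigr => k _.
    by case: ifP => _; rewrite ?mul1r// indicI.
  by move=> k; case: ifP => _ x => [[_]|]; exact: VK.
Qed.

Section process.
Variable w : point_process R.

(** The count is an integer, so a preimage is a countable union of the events generating the
    sigma-algebra. *)
Lemma measurable_npoints V : measurable (V : set RT) -> bounded_set V ->
  measurable_fun setT (fun o : pp_space w => fine (npoints V (w o))).
Proof.
move=> mV bV _ Y mY; rewrite setTI (_ : _ @^-1` _ = \bigcup_m
    (if m%:R \in Y then (w @^-1` [set u | npoints V u = m%:R%:E]) else set0)).
  apply: bigcupT_measurable => m; case: ifPn => // _.
  rewrite -[X in measurable X]setTI; apply: pp_measurable => //.
  by apply: sub_sigma_algebra; exists V, m.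
apply/seteqP; split => o /=.
  have [m mE] := npoints_nat (w o) bV; rewrite mE/= => Ym.
  by exists m => //; rewrite mem_set.
by move=> [m _]; case: ifPn => //; rewrite inE => Ym /= ->.
Qed.

Lemma measurable_box_count n (V : 'I_n -> set R) K : bounded_set K ->
  (forall i, measurable (V i : set RT)) -> (forall i, V i `<=` K) ->
  measurable_fun setT (fun o : pp_space w => box_count V (w o)).
Proof.
move=> bK; elim: n => [|n IH] in V *.
  move=> _ _; rewrite (_ : (fun o => _) = cst 1%E); first exact: measurable_cst.
  by apply/funext => o; rewrite box_count0.
move=> mV VK.
have -> : (fun o => box_count V (w o)) = fun o => (fine (npoints (V ord0) (w o)) *
    fine (box_count (fun i => V (lift ord0 i)) (w o)) -
    \sum_(i < n) fine (box_count (fun k =>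
      if k == i then V ord0 `&` V (lift ord0 k) else V (lift ord0 k)) (w o)))%:E.
  by apply/funext => o; exact: (box_countS _ bK VK).
have mfine (g : pp_space w -> \bar R) : measurable_fun setT g ->
    measurable_fun setT (fun o => fine (g o)).
  by move=> mg; exact: (measurableT_comp (@fine_measurable _ setT measurableT)).
have bV0 : bounded_set (V ord0).
  have [M [Mr h]] := bK; exists M; split => // y My x /VK; exact: h.
apply/measurable_EFinP; apply: measurable_funB.
  apply: measurable_funM; first exact: measurable_npoints.
  by apply: mfine; apply: IH.
apply: measurable_sum => i; apply: mfine; apply: IH => k.
  by case: ifP => _ //; exact: measurableI.
by case: ifP => _ x => [[_]|]; exact: VK.
Qed.

End process.
End box_count_measurable.

(** * Averages of random measures and the Campbell formula *)

Section mixture.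
Local Open Scope ereal_scope.
Context d d' (X : measurableType d) (Y : measurableType d') (R : realType).
Variable P : {measure set X -> \bar R}.
Variable l : X -> {measure set Y -> \bar R}.
Hypothesis ml : forall A, measurable A -> measurable_fun setT (fun x => l x A).

(* The proof of measurability is an argument so that the measure structure can
   be declared on [mixture_of]. *)
Definition mixture_of (_ : forall A, measurable A -> measurable_fun setT (fun x => l x A))
  (A : set Y) : \bar R := \int[P]_x l x A.

Local Notation mixture := (mixture_of ml).

Let mixture0 : mixture set0 = 0.
Proof. by rewrite /mixture_of integral0_eq// => x _; rewrite measure0. Qed.

Let mixture_ge0 A : 0 <= mixture A.
Proof. exact: integral_ge0. Qed.

Let mixture_sigma_additive : semi_sigma_additive mixture.
Proof.
move=> F mF tF mUF.
have -> : mixture (\bigcup_n F n) = \sum_(i <oo) mixture (F i).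
  rewrite -integral_nneseries//; last by move=> i; exact: ml.
  apply: eq_integral => x _; apply/esym/cvg_lim => //.
  exact: measure_semi_sigma_additive.
by apply: is_cvg_nneseries => i _ _; exact: mixture_ge0.
Qed.

HB.instance Definition _ := isMeasure.Build _ _ _ mixture
  mixture0 mixture_ge0 mixture_sigma_additive.

Import HBNNSimple.

Let integral_mixture_nnsfun (h : {nnsfun Y >-> R}) :
  \int[mixture]_y (h y)%:E = \int[P]_x \int[l x]_y (h y)%:E.
Proof.
under [RHS]eq_integral do rewrite integralT_nnsfun sintegralE.
have h0 r x : 0 <= r%:E * l x (h @^-1` [set r]).
  have [r0|r0] := leP 0%R r; first by rewrite mule_ge0.
  by rewrite preimage_nnfun0// measure0 mule0.
have mh r : measurable_fun setT (fun x => l x (h @^-1` [set r])) by exact: ml.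
rewrite integralT_nnsfun sintegralE ge0_integral_fsum//; last first.
  by move=> r; exact: measurable_funeM.
apply: eq_fsbigr => r _; have [r0|r0] := leP 0%R r; first by rewrite ge0_integralZl.
rewrite [LHS](_ : _ = 0); last by rewrite preimage_nnfun0// measure0 mule0.
by rewrite integral0_eq// => x _; rewrite preimage_nnfun0// measure0 mule0.
Qed.

Lemma integral_mixture (f : Y -> \bar R) :
  measurable_fun setT f -> (forall y, 0 <= f y) ->
  \int[mixture]_y f y = \int[P]_x \int[l x]_y f y.
Proof.
move=> mf f0; pose h := nnsfun_approx measurableT mf.
have h0 k y : 0 <= (h k y)%:E by rewrite lee_fin.
have mh k : measurable_fun setT (EFin \o h k) by exact/measurable_EFinP.
have hE y : f y = limn (fun k => (h k y)%:E).
  by apply/esym/cvg_lim => //; exact: cvg_nnsfun_approx.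
have ndh y : nondecreasing_seq (fun k => (h k y)%:E).
  by move=> i k ik; rewrite lee_fin; exact/lefP/nd_nnsfun_approx.
have fE (m : {measure set Y -> \bar R}) : \int[m]_y f y = limn (fun k => \int[m]_y (h k y)%:E).
  by rewrite -monotone_convergence//; apply: eq_integral => y _; exact: hE.
rewrite fE; under [RHS]eq_integral do rewrite fE.
rewrite monotone_convergence//.
- by congr (limn _); apply/funext => k; exact: integral_mixture_nnsfun.
- by move=> k; exact: (measurable_fun_integral_kernel ml (h0 k) (mh k)).
- by move=> k x _; exact: integral_ge0.
- by move=> x _ i k ik; apply: ge0_le_integral;
  [|move=> y _; exact: h0|exact: mh|exact: mh|move=> y _; exact: ndh].
Qed.

End mixture.

Section campbell.
Context {R : realType}.
Notation RT := (measurableTypeR R).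
Variable w : point_process R.
Variable n : nat.

Lemma distinct_measure_open_box (p q : 'I_n -> R) (u : configuration R) :
  distinct_measure n u (open_box p q) = box_count (fun i => `]p i, q i[%classic) u.
Proof.
rewrite distinct_measureE; last exact: measurable_open_box.
apply: eq_esum => j _; congr EFin.
by rewrite indic_open_box; apply: eq_bigr => i _; rewrite tnth_mktuple.
Qed.

Lemma bounded_ooitv (p q : R) : bounded_set `]p, q[%classic.
Proof.
exists (`|p| + `|q|); split; first exact: num_real.
move=> y My x /=; rewrite in_itv/= => /andP[px xq].
have := ler_norm q; have := ler_norm (- p); rewrite normrN => h1 h2.
have := normr_ge0 p; have := normr_ge0 q => h3 h4.
rewrite ler_norml; lra.
Qed.

Let bounded_box (p q : 'I_n -> R) : exists2 K : set R, bounded_set K &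
  forall i, `]p i, q i[%classic `<=` K.
Proof.
exists `](- \sum_i `|p i| - 1)%R, (\sum_i `|q i| + 1)%R[%classic; first exact: bounded_ooitv.
move=> i x /=; rewrite !in_itv/= => /andP[px xq].
have hp : `|p i| <= \sum_i `|p i| by rewrite (bigD1 i)//= lerDl sumr_ge0.
have hq : `|q i| <= \sum_i `|q i| by rewrite (bigD1 i)//= lerDl sumr_ge0.
have := ler_norm (q i); have := ler_norm (- p i); rewrite normrN => h1 h2.
by apply/andP; split; lra.
Qed.

Lemma distinct_measure_open_box_lty (p q : 'I_n -> R) (u : configuration R) :
  (distinct_measure n u (open_box p q) < +oo)%E.
Proof.
have [K bK pqK] := bounded_box p q.
by rewrite -ge0_fin_numE// distinct_measure_open_box (box_count_fin u bK).
Qed.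

(** On boxes the measure is a [box_count]. Dynkin's argument is run inside a fixed [B m], where the
    measure is finite so that differences make sense; letting [m] grow then gives all measurable
    sets. *)
Lemma measurable_distinct_measure (A : set (n.-tuple RT)) : measurable A ->
  measurable_fun setT (fun o : pp_space w => distinct_measure n (w o) A).
Proof.
pose B (m : nat) : set (n.-tuple RT) := centered_box m.
have mB m : measurable (B m) by exact: measurable_open_box.
have mbox (p q : 'I_n -> R) : measurable_fun setT (fun o : pp_space w => distinct_measure n (w o) (open_box p q)).
  have [K bK pqK] := bounded_box p q.
  rewrite (_ : (fun o => _) = (fun o : pp_space w => box_count (fun i => `]p i, q i[%classic) (w o))).
    refine (@measurable_box_count R w n (fun i => `]p i, q i[%classic) K bK _ pqK).
    by move=> i; exact: measurable_itv.
  by apply/funext => o; exact: distinct_measure_open_box.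
have loc m (C : set (n.-tuple RT)) : measurable C ->
    measurable_fun setT (fun o : pp_space w => distinct_measure n (w o) (C `&` B m)).
  pose H (C : set (n.-tuple RT)) := measurable C /\
    measurable_fun setT (fun o : pp_space w => distinct_measure n (w o) (C `&` B m)).
  suff : <<s [set: n.-tuple RT], @open_boxes R n >> `<=` H.
    by move=> h mC; apply: (h C _).2; rewrite -measurable_tupleE.
  apply: lambda_system_subset => //.
  - exact: open_boxes_setI.
  - split => //.
    + split => //; rewrite (_ : (fun o => _) = (fun o => distinct_measure n (w o) (B m))).
        exact: mbox.
      by apply/funext => o; rewrite setTI.
    + move=> C1 C2 C21 [mC1 fC1] [mC2 fC2]; split; first exact: measurableD.
      rewrite (_ : (fun o => _) = (fun o => distinct_measure n (w o) (C1 `&` B m) -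
          distinct_measure n (w o) (C2 `&` B m))%E); first exact: emeasurable_funB.
      apply/funext => o; rewrite setIDAC setIDA (measureD (measurableI _ _ mC1 (mB m)) mC2); last first.
      * rewrite (le_lt_trans _ (distinct_measure_open_box_lty (fun=> - m%:R) (fun=> m%:R) (w o)))//.
        by apply: le_measure; rewrite ?inE; [exact: measurableI|exact: mB|exact: subIsetr].
      * by congr (_ - distinct_measure n _ _)%E; rewrite setIAC (setIidr C21).
    + move=> F ndF HF; split; first by apply: bigcupT_measurable => k; exact: (HF k).1.
      apply: (emeasurable_fun_cvg (fun k o => distinct_measure n (w o) (F k `&` B m))) => [k|o _].
        exact: (HF k).2.
      rewrite setI_bigcupl; apply: nondecreasing_cvg_mu.
      * by move=> k; apply: measurableI => //; exact: (HF k).1.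
      * by apply: bigcupT_measurable => k; apply: measurableI => //; exact: (HF k).1.
      * by move=> i k ik; apply/subsetPset; apply: setSI; exact/subsetPset/ndF.
  - move=> _ [p [q ->]]; split; first exact: measurable_open_box.
    by have [p' [q' ->]] := open_boxes_setI (ex_intro _ p (ex_intro _ q erefl))
       (ex_intro _ _ (ex_intro _ _ (erefl (B m)))).
move=> mA.
apply: (emeasurable_fun_cvg (fun k o => distinct_measure n (w o) (A `&` B k))) => [k|o _].
  exact: loc.
rewrite -[X in _ --> distinct_measure n _ X]setIT -(bigcup_centered_box n) setI_bigcupr.
apply: nondecreasing_cvg_mu.
- by move=> k; exact: measurableI.
- by apply: bigcupT_measurable => k; exact: measurableI.
- by move=> i k ik; apply/subsetPset; apply: setIS; exact/subsetPset/centered_box_nd.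
Qed.

(** The [n]-th factorial moment measure of [w]; the next lemma is Campbell's formula for it. *)
Definition correlation_measure : {measure set (n.-tuple RT) -> \bar R} :=
  mixture_of (pp_prob w) measurable_distinct_measure.

Lemma integral_correlation_measure (f : n.-tuple RT -> \bar R) :
  measurable_fun setT f -> (forall t, 0 <= f t)%E ->
  (\int[correlation_measure]_t f t =
   \int[pp_prob w]_o \esum_(j in distinct_tuples (w o)) f (point_tuple (w o) j))%E.
Proof.
move=> mf f0; rewrite integral_mixture//.
by apply: eq_integral => o _; rewrite integral_distinct_measure.
Qed.

Lemma measurable_esum_distinct (f : n.-tuple RT -> \bar R) :
  measurable_fun setT f -> (forall t, 0 <= f t)%E ->
  measurable_fun setT (fun o : pp_space w =>
    \esum_(j in distinct_tuples (w o)) f (point_tuple (w o) j))%E.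
Proof.
move=> mf f0; under eq_fun do rewrite -integral_distinct_measure//.
by apply: measurable_fun_integral_kernel => //; exact: measurable_distinct_measure.
Qed.

End campbell.

(** * Correlation measures of Poisson processes *)

Section bumps.
Context {R : realType}.
Notation RT := (measurableTypeR R).
Variable n : nat.
Variables p q : 'I_n -> R.

(** Continuous and positive exactly on the open box, which is what makes the truncations of its
    multiples increase to the indicator. *)
Definition depth (x : 'rV[R]_n) : R :=
  \prod_i Num.max 0 (Num.min (x ord0 i - p i) (q i - x ord0 i)).

(* Continuous functions increasing to the indicator of [open_box p q]. *)
Definition bump (k : nat) (x : 'rV[R]_n) : R := Num.min 1 (k%:R * depth x).

Lemma depth_ge0 x : 0 <= depth x.
Proof. by apply: prodr_ge0 => i _; rewrite le_max lexx. Qed.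

Lemma bump_ge0 k x : 0 <= bump k x.
Proof. by rewrite le_min ler01 mulr_ge0// depth_ge0. Qed.

Lemma depth_gt0 (t : n.-tuple RT) : (0 < depth (rV_of_tuple t)) <-> open_box p q t.
Proof.
split => [d0 i|pqt].
  have : Num.max 0 (Num.min ((tnth t i : R) - p i) (q i - tnth t i)) != 0.
    by have := lt0r_neq0 d0; apply: contraNneq => h; rewrite /depth (bigD1 i)//= !mxE h mul0r.
  rewrite neq_lt gt_max ltxx/= lt_max ltxx/= lt_min !subr_gt0 => /andP[-> ->] //.
apply: prodr_gt0 => i _; rewrite !mxE lt_max lt_min !subr_gt0 ltxx/=; exact: pqt.
Qed.

Lemma continuous_bump k : continuous (bump k).
Proof.
have cc i : continuous (fun x : 'rV[R]_n => x ord0 i) by exact: coord_continuous.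
have cd : continuous depth.
  apply: (@continuous_big R 'I_n *%R 1 xpredT (@mul_continuous _) 'rV[R]_n (index_enum _)
    (fun i y => Num.max 0 (Num.min (y ord0 i - p i) (q i - y ord0 i)))) => i _ x.
  apply: (@continuous_max R _ (cst 0)
    ((fun y : 'rV[R]_n => y ord0 i - p i) \min (fun y => q i - y ord0 i))).
    exact: cst_continuous.
  apply: (@continuous_min R _ (fun y : 'rV[R]_n => y ord0 i - p i) (fun y => q i - y ord0 i)).
    by apply: (@continuousB _ _ _ (fun y : 'rV[R]_n => y ord0 i) (cst (p i)));
      [exact: cc|exact: cst_continuous].
  by apply: (@continuousB _ _ _ (cst (q i)) (fun y : 'rV[R]_n => y ord0 i));
    [exact: cst_continuous|exact: cc].
move=> x; apply: (@continuous_min R _ (cst 1) (fun y => k%:R * depth y)).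
  exact: cst_continuous.
by apply: (@continuousM _ _ (cst k%:R) depth); [exact: cst_continuous|exact: cd].
Qed.

Lemma bump_neq0 k x : bump k x != 0 -> forall i, p i <= x ord0 i <= q i.
Proof.
move=> b0 i.
have : Num.max 0 (Num.min (x ord0 i - p i) (q i - x ord0 i)) != 0.
  apply: contraNneq b0 => h; rewrite /bump /depth (bigD1 i)//= h mul0r mulr0.
  by apply/eqP/min_idPr.
rewrite neq_lt gt_max ltxx/= lt_max ltxx/= lt_min !subr_gt0 => /andP[? ?].
by rewrite !ltW.
Qed.

Lemma bump_compact_support k : cont_compact_support (fun x => (bump k x)%:C%C).
Proof.
split => //=; first exact: continuous_bump; first by move=> x; exact: cst_continuous.
have cK : compact [set v : 'rV[R]_n | forall i, `[p i, q i]%classic (v ord0 i)].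
  by apply: (@rV_compact R n (fun i => `[p i, q i]%classic)) => i; exact: segment_compact.
apply: (subclosed_compact _ cK); first exact: closed_closure.
rewrite [X in _ `<=` X](closure_id _).1; last first.
  by apply: compact_closed cK; exact: norm_hausdorff.
apply: closureS => x /=; rewrite eq_complex /= eqxx andbT => b0 i.
by rewrite in_itv/=; exact: bump_neq0 b0 i.
Qed.

Lemma nd_bump (t : n.-tuple RT) : nondecreasing_seq (fun k => bump k (rV_of_tuple t)).
Proof.
move=> i k ik /=; rewrite /bump le_min !ge_min lexx/=; apply/orP; right.
by rewrite ler_wpM2r ?depth_ge0 ?ler_nat.
Qed.

Lemma cvg_bump (t : n.-tuple RT) :
  (bump k (rV_of_tuple t))%:E @[k --> \oo] --> (\1_(open_box p q) t : R)%:E.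
Proof.
set d := depth (rV_of_tuple t).
have [d0|d0] := ltP 0 d.
  rewrite indicE mem_set; last exact/depth_gt0.
  apply: cvg_near_cst; exists (Num.trunc d^-1).+1 => // k /= kd; congr EFin.
  apply/min_idPl; rewrite -/d -ler_pdivrMr// div1r (le_trans (ltW (truncnS_gt _)))//.
  by rewrite ler_nat.
rewrite indicE memNset; last by move=> /depth_gt0; rewrite -/d ltNge d0.
apply: cvg_near_cst; apply: nearW => k; congr EFin.
rewrite /bump -/d (le_anti (introT andP (conj d0 (depth_ge0 _)))) mulr0.
by apply/min_idPr.
Qed.

Lemma measurable_bump k : measurable_fun setT (fun t : n.-tuple RT => bump k (rV_of_tuple t)).
Proof. by apply: continuous_measurable_rV; exact: continuous_bump. Qed.

Lemma cvg_integral_bump (m : {measure set (n.-tuple RT) -> \bar R}) :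
  (\int[m]_t (bump k (rV_of_tuple t))%:E @[k --> \oo] --> m (open_box p q))%E.
Proof.
have -> : m (open_box p q) = (\int[m]_t (limn (fun k => (bump k (rV_of_tuple t))%:E)))%E.
  transitivity (\int[m]_t (\1_(open_box p q) t)%:E)%E.
    by rewrite integral_indic ?setIT//; exact: measurable_open_box.
  by apply: eq_integral => t _; apply/esym/cvg_lim => //; exact: cvg_bump.
apply: cvg_monotone_convergence => //.
- by move=> k; apply/measurable_EFinP; exact: measurable_bump.
- by move=> k t _; rewrite lee_fin bump_ge0.
- by move=> t _ i k ik; rewrite lee_fin; exact: nd_bump.
Qed.

Lemma lebesgue_tuple_open_box : (forall i, p i <= q i) ->
  lebesgue_tuple n (open_box p q) = (\prod_i (q i - p i))%:E.
Proof.
move=> pq; have mpq i : measurable (`]p i, q i[%classic : set RT) by exact: measurable_itv.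
transitivity (\int[lebesgue_tuple n]_t
    (\prod_i (\1_(`]p i, q i[%classic : set RT) (tnth t i) : R))%:E)%E.
  transitivity (\int[lebesgue_tuple n]_t (\1_(open_box p q) t)%:E)%E.
    by rewrite integral_indic ?setIT//; exact: measurable_open_box.
  by apply: eq_integral => t _; rewrite indic_open_box.
rewrite (integral_prod_lebesgue_tuple (q := fun i => \1_(`]p i, q i[%classic : set RT)))//.
rewrite -prodEFin; apply: eq_bigr => i _.
rewrite integral_indic// setIT.
have h := @lebesgue_measure_itv R `]p i, q i[; rewrite /= lte_fin in h.
rewrite [LHS]h {h}; by have [//|h] := ltP (p i) (q i); rewrite (le_anti (introT andP (conj (pq i) h))) subrr.
Qed.

End bumps.

Lemma lebesgue_tuple_open_box_lty {R : realType} n (p q : 'I_n -> R) :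
  (lebesgue_tuple n (open_box p q) < +oo)%E.
Proof.
(* The volume formula needs ordered endpoints; enlarging the box reduces to that case. *)
pose q' i := Num.max (p i) (q i).
apply: (@le_lt_trans _ _ (lebesgue_tuple n (open_box p q'))).
  apply: le_measure; rewrite ?inE; [exact: measurable_open_box|exact: measurable_open_box|].
  by move=> t pqt i; have /andP[-> h] := pqt i; rewrite lt_max h orbT.
by rewrite lebesgue_tuple_open_box ?ltry// => i; rewrite le_max lexx.
Qed.

Section poisson_correlation.
Context {R : realType}.
Notation RT := (measurableTypeR R).

Lemma distinct_sum_ge0 n (f : 'rV[R]_n -> R) (u : configuration R) :
  (forall x, 0 <= f x) -> distinct_sum f u =
  (\esum_(j in distinct_tuples u) (f (rV_of_tuple (point_tuple u j)))%:E)%E.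
Proof.
move=> f0; rewrite /distinct_sum [X in (_ - X)%E]esum1 ?sube0.
  by apply: eq_esum => j _; rewrite row_point_tuple (max_idPl _).
by move=> j _; rewrite (max_idPr _)// oppr_le0.
Qed.

Variables (lambda : R) (w : point_process R).
Hypothesis lambda_gt0 : 0 < lambda.
Hypothesis wP : is_poisson lambda w.

Lemma correlation_measure_bump n (p q : 'I_n -> R) k : (0 < n)%N ->
  (\int[correlation_measure w n]_t (bump p q k (rV_of_tuple t))%:E =
   (lambda ^+ n)%:E * \int[lebesgue_tuple n]_t (bump p q k (rV_of_tuple t))%:E)%E.
Proof.
move=> n0; set b := bump p q k.
have b0 x : 0 <= b x by exact: bump_ge0.
have mb : measurable_fun setT (fun t : n.-tuple RT => (b (rV_of_tuple t))%:E).
  by apply/measurable_EFinP; exact: measurable_bump.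
rewrite integral_correlation_measure//; last by move=> t; rewrite lee_fin.
transitivity (\int[pp_prob w]_o distinct_sum (fun x => complex.Re (b x)%:C%C) (w o))%E.
  by apply: eq_integral => o _; rewrite distinct_sum_ge0.
have /(congr1 fst)/= -> := wP n0 (bump_compact_support p q k).
rewrite -ge0_integralZl//; last 2 first.
- by move=> t _; rewrite lee_fin.
- by rewrite lee_fin exprn_ge0// ltW.
have bE : (\int[lebesgue_tuple n]_t (complex.Re ((b (rV_of_tuple t))%:C%C * (lambda ^+ n)%:C%C))%:E =
    \int[lebesgue_tuple n]_t ((lambda ^+ n)%:E * (b (rV_of_tuple t))%:E))%E.
  by apply: eq_integral => t _; rewrite -EFinM /= mul0r subr0 mulrC.
(* The Poisson identity involves a real integral obtained through [fine]. Removing [fine] needs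
   finiteness, which holds because a bump is at most the indicator of its box. *)
rewrite /integral_Rn /Rintegral [X in fine X]bE fineK// ge0_integralZl//; last 2 first.
- by move=> t _; rewrite lee_fin.
- by rewrite lee_fin exprn_ge0// ltW.
rewrite fin_numM// ge0_fin_numE; last by apply: integral_ge0 => t _; rewrite lee_fin.
apply: le_lt_trans (lebesgue_tuple_open_box_lty p q).
rewrite (_ : lebesgue_tuple n _ = \int[lebesgue_tuple n]_t (\1_(open_box p q) t)%:E)%E; last first.
  by rewrite integral_indic ?setIT//; exact: measurable_open_box.
apply: ge0_le_integral => //.
- by move=> t _; rewrite lee_fin.
- apply/measurable_EFinP; apply: measurable_indic; exact: measurable_open_box.
move=> t _; rewrite lee_fin indicE.
have [pqt|pqt] := pselect (open_box p q t); first by rewrite mem_set// ge_min lexx.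
rewrite memNset//; move/depth_gt0: pqt; rewrite (rwP negP) -leNgt => d0.
by rewrite ge_min /= orbC mulr_ge0_le0.
Qed.

(** The identity on bumps passes to open boxes by monotone convergence on both sides, and from boxes
    to all measurable sets by [eq_measure_open_box]. *)
Lemma correlation_measure_poisson n (A : set (n.-tuple RT)) : (0 < n)%N -> measurable A ->
  correlation_measure w n A = ((lambda ^+ n)%:E * lebesgue_tuple n A)%E.
Proof.
move=> n0 mA.
have l0 : 0 <= lambda ^+ n by rewrite exprn_ge0// ltW.
pose m : {measure set (n.-tuple RT) -> \bar R} := mscale (NngNum l0) (lebesgue_tuple n).
have box p q : correlation_measure w n (open_box p q) = m (open_box p q).
  rewrite -(cvg_lim (@ereal_hausdorff R) (@cvg_integral_bump _ _ p q (correlation_measure w n))).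
  apply/cvg_lim => //.
  under eq_fun do rewrite correlation_measure_bump//.
  apply: cvgeZl; first by [].
  exact: cvg_integral_bump.
apply: (eq_measure_open_box (m2 := m)) mA; first exact: box.
move=> k; rewrite box /m /= /mscale/=.
apply: lte_mul_pinfty; [by rewrite lee_fin|by []|exact: lebesgue_tuple_open_box_lty].
Qed.

Lemma integral_correlation_poisson n (f : n.-tuple RT -> \bar R) : (0 < n)%N ->
  measurable_fun setT f -> (forall t, 0 <= f t)%E ->
  (\int[pp_prob w]_o (\esum_(j in distinct_tuples (w o)) f (point_tuple (w o) j)) =
   (lambda ^+ n)%:E * \int[lebesgue_tuple n]_t f t)%E.
Proof.
move=> n0 mf f0; rewrite -integral_correlation_measure//.
have l0 : 0 <= lambda ^+ n by rewrite exprn_ge0// ltW.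
rewrite -(ge0_integral_mscale _ _ (NngNum l0))//.
by apply: eq_measure_integral => A mA _; exact: correlation_measure_poisson.
Qed.

End poisson_correlation.

(** * Rounded processes *)

Section round_process.
Context {R : realType} (a : R).
Hypothesis a_gt0 : 0 < a.
Notation RT := (measurableTypeR R).

Lemma bounded_preimage_round (V : set R) : bounded_set V -> bounded_set (round a @^-1` V).
Proof.
move=> [M [Mr h]]; exists (M + a); split; first exact: num_real.
move=> y My x /= Vx.
have hx : `|round a x| <= y - a by apply: (h (y - a)) => //; rewrite ltrBrDr.
rewrite -[x in X in X <= _](subrK (round a x)) (le_trans (ler_normD _ _))//.
rewrite -[leRHS](subrK a) addrC lerD// (le_trans (dist_round a_gt0 x))//.
by rewrite ler_pdivrMr// ler_pMr// ler1n.
Qed.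

Lemma round_locally_finite (u : configuration R) (V : set R) : bounded_set V ->
  finite_set [set j | labels u j /\ V (round a (Defs.point u j))].
Proof. by move=> /bounded_preimage_round; exact: locally_finite. Qed.

(** Labels are kept: points rounded to the same site still count with multiplicity, and the tuples
    of distinct labels are those of [u]. *)
Definition round_configuration (u : configuration R) : configuration R :=
  Configuration (@round_locally_finite u).

Lemma measurable_round_configuration (w : point_process R) : measurable_fun setT
  ((fun o => round_configuration (w o)) : pp_space w -> g_sigma_algebraType (@npoints_events R)).
Proof.
apply: (@measurability _ _ _ (g_sigma_algebraType (@npoints_events R)) _ _ (@npoints_events R) erefl) => _ [_ [V [m [mV bV ->]]] <-].
rewrite setTI (_ : _ @^-1` _ = w @^-1` [set u | npoints (round a @^-1` V) u = m%:R%:E])//.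
rewrite -[X in measurable X]setTI; apply: pp_measurable => //.
apply: sub_sigma_algebra; exists (round a @^-1` V), m; split => //.
  rewrite -[X in measurable X]setTI; exact: (@measurable_round _ a a_gt0).
exact: bounded_preimage_round.
Qed.

Definition round_process (w : point_process R) : point_process R :=
  PointProcess (pp_prob w) (@measurable_round_configuration w).

Lemma point_tuple_round n (u : configuration R) (j : {ffun 'I_n -> nat}) :
  point_tuple (round_configuration u) j = round_tuple a (point_tuple u j).
Proof. by apply: eq_from_tnth => i; rewrite [RHS]tnth_map !tnth_mktuple. Qed.

End round_process.

(** * Uniform local moments from factorial moments *)

Section moments.
Context {R : realType}.
Notation RT := (measurableTypeR R).
Implicit Types (u : configuration R) (V : set R).

(** If [N] exceeds [2 * n], each factor [N - i] with [i < n] of the falling factorial is at least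
    half of [N]; otherwise the first term is enough. *)
Lemma expn_le_ffact (N n : nat) : (N ^ n <= (2 * n) ^ n + 2 ^ n * N ^_ n)%N.
Proof.
have [Nn|Nn] := leqP N (2 * n).
  by rewrite (leq_trans _ (leq_addr _ _))//; case: n Nn => // n Nn; rewrite leq_exp2r.
rewrite (leq_trans _ (leq_addl _ _))// ffact_prod -[X in (N ^ X)%N](card_ord n) -[X in (2 ^ X)%N](card_ord n).
rewrite -!prod_nat_const -big_split/=; apply: leq_prod => i _.
have iN : (2 * i <= N)%N by rewrite (leq_trans _ (ltnW Nn))// leq_mul2l ltnW ?orbT.
by rewrite mulnBr [(2 * N)%N]mul2n -addnn -addnBA// leq_addr.
Qed.

(** With all sets equal to [V], [box_count] is the falling factorial of the number of points in
    [V]. *)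
Lemma npoints_expn_le V u n : bounded_set V ->
  (npoints V u ^+ n <= ((2 * n) ^ n)%:R%:E + (2 ^ n)%:R%:E * box_count (fun _ : 'I_n => V) u)%E.
Proof.
move=> bV; have [s us sP] := enum_labels u bV.
have e1 (x : 'I_(size s)) : \1_V (Defs.point u (tnth (in_tuple s) x)) = 1 :> R.
  by rewrite indicE mem_set//; have /sP[] := mem_tnth x (in_tuple s).
rewrite (npoints_sum us sP (@subset_refl _ V)).
rewrite (box_count_uniq_sum us sP (fun=> @subset_refl _ V)).
under eq_bigr do rewrite e1.
rewrite sumr_const card_ord /uniq_sum.
under eq_bigr do rewrite big1//.
rewrite sumr_const.
rewrite (_ : #|_| = (size s ^_ n)%N); last first.
  rewrite -[X in (X ^_ _)%N](card_ord (size s)) -card_uniq_tuples.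
  by apply: eq_card => t; rewrite !inE unfold_in all_predT.
rewrite -EFin_expe -EFinM -EFinD lee_fin -natrX -natrM -natrD ler_nat.
exact: expn_le_ffact.
Qed.

Lemma npoints_le V V' u : bounded_set V' -> V `<=` V' -> (npoints V u <= npoints V' u)%E.
Proof.
move=> bV' VV'; have [s us sP] := enum_labels u bV'.
rewrite (npoints_sum us sP)// (npoints_sum us sP)// lee_fin; apply: ler_sum => x _.
by rewrite !indicE ler_nat; case: (boolP (_ \in V)) => //; rewrite inE => /VV' ?; rewrite mem_set.
Qed.

Lemma npoints_ge0 V u : (0 <= npoints V u)%E.
Proof. exact: measure_ge0. Qed.

Lemma npoints_expE V u n : bounded_set V ->
  (npoints V u ^+ n = (fine (npoints V u) ^+ n)%:E)%E.
Proof. by move=> bV; have [m ->] := npoints_nat u bV; rewrite -EFin_expe. Qed.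

Lemma npoints_exp_le V V' u n : bounded_set V -> bounded_set V' -> V `<=` V' ->
  (npoints V u ^+ n <= npoints V' u ^+ n)%E.
Proof.
move=> bV bV' VV'; have := npoints_le u bV' VV'.
have [m ->] := npoints_nat u bV; have [m' ->] := npoints_nat u bV'.
by rewrite -!EFin_expe !lee_fin => mm'; rewrite lerXn2r// nnegrE.
Qed.

Lemma measurable_npoints_exp (w : point_process R) V n : measurable (V : set RT) ->
  bounded_set V -> measurable_fun setT (fun o : pp_space w => npoints V (w o) ^+ n)%E.
Proof.
move=> mV bV; under eq_fun do rewrite npoints_expE//.
by apply/measurable_EFinP; apply: measurable_funX; exact: measurable_npoints.
Qed.

(** The [n]-th factorial moment of the count is the correlation measure of a cube, namely
    [lambda ^+ n * (q - p) ^+ n]. *)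
Lemma poisson_moment (lambda : R) (w : point_process R) (p q : R) n :
  0 < lambda -> is_poisson lambda w -> (0 < n)%N -> p <= q ->
  (\int[pp_prob w]_o (npoints `]p, q[%classic (w o)) ^+ n <=
   (((2 * n) ^ n)%:R + (2 ^ n)%:R * (lambda ^+ n * (q - p) ^+ n))%:E)%E.
Proof.
move=> l0 wP n0 pq; have bV := @bounded_ooitv R p q.
have mV : measurable (`]p, q[%classic : set RT) by exact: measurable_itv.
have mb : measurable_fun setT (fun o : pp_space w => box_count (fun _ : 'I_n => `]p, q[%classic) (w o)).
  exact: (@measurable_box_count R w n (fun=> `]p, q[%classic) _ bV (fun=> mV) (fun=> @subset_refl _ _)).
have b0 o : (0 <= box_count (fun _ : 'I_n => `]p, q[%classic) (w o))%E.
  by apply: esum_ge0 => j _; rewrite lee_fin prodr_ge0.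
apply: (@le_trans _ _ (\int[pp_prob w]_o (((2 * n) ^ n)%:R%:E +
   (2 ^ n)%:R%:E * box_count (fun _ : 'I_n => `]p, q[%classic) (w o)))%E).
  apply: ge0_le_integral => //.
  - by move=> o _; rewrite npoints_expE// lee_fin exprn_ge0// fine_ge0// npoints_ge0.
  - exact: measurable_npoints_exp.
  - by apply: emeasurable_funD => //; exact: measurable_funeM.
  - by move=> o _; exact: npoints_expn_le.
rewrite ge0_integralD//; last 2 first.
- by move=> o _; rewrite mule_ge0// lee_fin.
- exact: measurable_funeM.
have -> : (\int[pp_prob w]_o ((2 * n) ^ n)%:R%:E = ((2 * n) ^ n)%:R%:E)%E.
  rewrite integral_cst; last exact: measurableT.
  by rewrite [X in (_ * X = _)%E](@probability_setT _ _ _ (pp_prob w)) mule1.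
rewrite ge0_integralZl//.
rewrite EFinD EFinM leeD2l// lee_wpmul2l ?lee_fin//.
rewrite (_ : \int[pp_prob w]_o _ = correlation_measure w n (open_box (fun=> p) (fun=> q)))%E; last first.
  by apply: eq_integral => o _; rewrite distinct_measure_open_box.
rewrite (correlation_measure_poisson l0 wP n0); last exact: measurable_open_box.
by rewrite lebesgue_tuple_open_box// prodr_const card_ord EFinM.
Qed.

End moments.

Section mimicry.
Context {R : realType}.
Notation RT := (measurableTypeR R).
Variables (lambda a : R).
Hypothesis lambda_gt0 : 0 < lambda.
Hypothesis a_gt0 : 0 < a.

Let bounded_unit_itv (L : R) : bounded_set `[L, (L + 1)%R]%classic.
Proof.
have [M [Mr h]] := @bounded_ooitv R (L - 1) (L + 2).
exists M; split => // y My x /=; rewrite in_itv/= => /andP[Lx xL]; apply: (h y My).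
by rewrite /= in_itv/=; apply/andP; split; lra.
Qed.

Let unit_itv_sub (L : R) : `[L, (L + 1)%R]%classic `<=` `](L - a)%R, (L + 1 + a)%R[%classic.
Proof.
move=> x /=; rewrite !in_itv/= => /andP[Lx xL]; apply/andP; split.
  by rewrite (lt_le_trans _ Lx)// ltrBlDr ltrDl.
by rewrite (le_lt_trans xL)// ltrDl.
Qed.

Let round_unit_itv_sub (L : R) :
  round a @^-1` `[L, (L + 1)%R]%classic `<=` `](L - a)%R, (L + 1 + a)%R[%classic.
Proof.
move=> x /=; rewrite !in_itv/= => /andP[Lx xL].
have := dist_round a_gt0 x; rewrite ler_distl => /andP[h1 h2].
have a2 : a / 2 < a by rewrite ltr_pdivrMr// ltr_pMr// ltr1n.
apply/andP; split.
  by rewrite (lt_le_trans _ h1)// (lt_le_trans (y := L - a / 2))// ?ltrD2l ?ltrN2 ?lerD2r.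
by rewrite (le_lt_trans h2)// (@le_lt_trans _ _ (L + 1 + a / 2))// ?lerD2r ?ltrD2l.
Qed.

(** The interval of length [1 + 2 * a] contains both the unit interval and its preimage under
    rounding, so one constant, independent of [L], serves the process and its rounding. *)
Let moment_bound (w : point_process R) n : is_poisson lambda w -> (0 < n)%N ->
  exists C : R, forall (L : R) (V : set R), measurable (V : set RT) -> bounded_set V ->
    V `<=` `](L - a)%R, (L + 1 + a)%R[%classic ->
    (\int[pp_prob w]_o (npoints V (w o)) ^+ n <= C%:E)%E.
Proof.
move=> wP n0; exists (((2 * n) ^ n)%:R + (2 ^ n)%:R * (lambda ^+ n * (1 + 2 * a) ^+ n)).
move=> L V mV bV VL; have bI := @bounded_ooitv R (L - a) (L + 1 + a).
have LL : L - a <= L + 1 + a by have a0 := a_gt0; lra.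
have := poisson_moment lambda_gt0 wP n0 LL.
rewrite (_ : L + 1 + a - (L - a) = 1 + 2 * a); last by ring.
apply: le_trans; apply: ge0_le_integral => //.
- by move=> o _; rewrite npoints_expE// lee_fin exprn_ge0// fine_ge0// npoints_ge0.
- exact: measurable_npoints_exp.
- by apply: measurable_npoints_exp => //; exact: measurable_itv.
- by move=> o _; exact: npoints_exp_le.
Qed.

Lemma poisson_ulm (w : point_process R) : is_poisson lambda w -> ulm w.
Proof.
move=> wP n n0; have [C HC] := moment_bound wP n0; exists C => L.
by apply: (HC L) => //; exact: measurable_itv.
Qed.

Lemma round_process_ulm (w : point_process R) : is_poisson lambda w -> ulm (round_process a_gt0 w).
Proof.
move=> wP n n0; have [C HC] := moment_bound wP n0; exists C => L.
apply: (HC L (round a @^-1` `[L, (L + 1)%R]%classic)) => //.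
- rewrite -[X in measurable X]setTI; exact: (@measurable_round _ a a_gt0 measurableT _ (measurable_itv `[L, (L + 1)%R])).
- exact: bounded_preimage_round.
Qed.

Lemma round_process_supported (w : point_process R) :
  supported_on (lattice a) (round_process a_gt0 w).
Proof. by move=> o j _; exact: round_lattice. Qed.

(** The sums of positive and of negative parts have finite expectations, since [F] is integrable for
    a multiple of the correlation measure; hence the expectation of their difference splits. *)
Lemma integral_signed_sum (w : point_process R) n (F : n.-tuple RT -> R) :
  is_poisson lambda w -> (0 < n)%N ->
  (lebesgue_tuple n).-integrable setT (EFin \o F) ->
  (\int[pp_prob w]_o (\esum_(j in distinct_tuples (w o)) (Num.max (F (point_tuple (w o) j)) 0)%:E -
     \esum_(j in distinct_tuples (w o)) (Num.max (- F (point_tuple (w o) j)) 0)%:E) =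
   (lambda ^+ n)%:E * \int[lebesgue_tuple n]_t (F t)%:E)%E.
Proof.
move=> wP n0 iF.
have mF : measurable_fun setT F by apply/measurable_EFinP; exact: measurable_int iF.
have posE (G : n.-tuple RT -> R) : (lebesgue_tuple n).-integrable setT (EFin \o G) ->
    (pp_prob w).-integrable setT (fun o =>
      \esum_(j in distinct_tuples (w o)) (Num.max (G (point_tuple (w o) j)) 0)%:E)%E /\
    (\int[pp_prob w]_o (\esum_(j in distinct_tuples (w o)) (Num.max (G (point_tuple (w o) j)) 0)%:E) =
     (lambda ^+ n)%:E * \int[lebesgue_tuple n]_t ((EFin \o G)^\+ t))%E.
  move=> iG; have mG : measurable_fun setT G by apply/measurable_EFinP; exact: measurable_int iG.
  have mG' : measurable_fun setT (fun t => (Num.max (G t) 0)%:E).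
    by apply/measurable_EFinP; exact: measurable_maxr.
  have G0 t : (0 <= (Num.max (G t) 0)%:E)%E by rewrite lee_fin le_max lexx orbT.
  have E := integral_correlation_poisson lambda_gt0 wP n0 mG' G0.
  have E2 : (\int[lebesgue_tuple n]_t (Num.max (G t) 0)%:E =
      \int[lebesgue_tuple n]_t ((EFin \o G)^\+ t))%E.
    by apply: eq_integral => t _; rewrite funeposE/= EFin_max.
  have S0 o : (0 <= \esum_(j in distinct_tuples (w o)) (Num.max (G (point_tuple (w o) j)) 0)%:E)%E.
    by apply: esum_ge0 => j _.
  split; last by rewrite E E2.
  apply/integrableP; split; first exact: (@measurable_esum_distinct _ w n _ mG' G0).
  under eq_integral do rewrite gee0_abs//.
  rewrite E E2; apply: lte_mul_pinfty => //; first by rewrite lee_fin exprn_ge0// ltW.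
  exact: integral_funepos_lt_pinfty.
have [i1 E1] := posE F iF.
have iFN : (lebesgue_tuple n).-integrable setT (EFin \o (fun t => - F t)).
  by apply: eq_integrable (integrableN iF).
have [i2 E2] := posE (fun t => - F t) iFN.
rewrite integralB// E1 E2 [in RHS]integralE.
have -> : (\int[lebesgue_tuple n]_t ((EFin \o (fun t => - F t)%R)^\+ t) =
    \int[lebesgue_tuple n]_t ((EFin \o F)^\- t))%E.
  by apply: eq_integral => t _; rewrite funeposE funenegE /= EFinN.
have f1 := integrable_pos_fin_num measurableT iF.
have f2 := integrable_neg_fin_num measurableT iF.
by apply/esym/muleBr => //; exact: fin_num_adde_defr.
Qed.

Lemma correlation_poisson (w : point_process R) n (eta : 'rV[R]_n -> R[i]) :
  is_poisson lambda w -> (0 < n)%N -> schwartz eta ->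
  correlation w eta =
  ((lambda ^+ n)%:E * \int[lebesgue_tuple n]_t (complex.Re (eta (rV_of_tuple t)))%:E,
   (lambda ^+ n)%:E * \int[lebesgue_tuple n]_t (complex.Im (eta (rV_of_tuple t)))%:E)%E.
Proof.
move=> wP n0 [sR sI]; congr pair.
  rewrite -(integral_signed_sum wP n0 (integrable_schwartz sR)).
  apply: eq_integral => o _; congr (_ - _)%E;
    by apply: eq_esum => j _; rewrite row_point_tuple.
rewrite -(integral_signed_sum wP n0 (integrable_schwartz sI)).
apply: eq_integral => o _; congr (_ - _)%E;
  by apply: eq_esum => j _; rewrite row_point_tuple.
Qed.

(** Tuples of the rounded process are rounded tuples of [w], so the correlation is an integral of
    [eta] at rounded points; [poisson_summation] removes the rounding. *)
Lemma correlation_round_poisson (w : point_process R) n (eta : 'rV[R]_n -> R[i]) :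
  is_poisson lambda w -> (0 < n)%N -> schwartz eta ->
  support_Rn (fourier eta) `<=` cube (1 / (2 * a)) ->
  correlation (round_process a_gt0 w) eta =
  ((lambda ^+ n)%:E * \int[lebesgue_tuple n]_t (complex.Re (eta (rV_of_tuple t)))%:E,
   (lambda ^+ n)%:E * \int[lebesgue_tuple n]_t (complex.Im (eta (rV_of_tuple t)))%:E)%E.
Proof.
move=> wP n0 se supp; have [sR sI] := se; congr pair.
  rewrite -(poisson_summation a_gt0 se supp (or_introl erefl)).
  rewrite -(integral_signed_sum wP n0 (integrable_schwartz_round a_gt0 sR)).
  apply: eq_integral => o _; congr (_ - _)%E;
    by apply: eq_esum => j _; rewrite (row_point_tuple (round_configuration a_gt0 (w o))) point_tuple_round.
rewrite -(poisson_summation a_gt0 se supp (or_intror erefl)).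
rewrite -(integral_signed_sum wP n0 (integrable_schwartz_round a_gt0 sI)).
apply: eq_integral => o _; congr (_ - _)%E;
  by apply: eq_esum => j _; rewrite (row_point_tuple (round_configuration a_gt0 (w o))) point_tuple_round.
Qed.

Lemma round_process_mimics (w w' : point_process R) :
  is_poisson lambda w -> is_poisson lambda w' ->
  mimics (1 / (2 * a)) (round_process a_gt0 w) w'.
Proof.
move=> wP w'P; split; [exact: poisson_ulm|exact: round_process_ulm|].
by move=> n eta n0 se supp; rewrite correlation_poisson// correlation_round_poisson.
Qed.

End mimicry.

Section empty_process.
Context {R : realType}.

(** A witness for the case where no Poisson process is given; the sample space carries a single unit
    mass. *)
Definition empty_process : point_process R :=
  @PointProcess R _ (measurableTypeR R) (dirac (0 : measurableTypeR R))
    (cst (empty_configuration : g_sigma_algebraType (@npoints_events R)))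
    (measurable_cst _).

Lemma empty_process_ulm : ulm empty_process.
Proof.
move=> n n0; exists 0 => L; rewrite integral0_eq// => o _.
rewrite /npoints (_ : [set j | _] = set0) ?measure0 ?expe0n//; last first.
  by apply/seteqP; split => // j [].
by case: n n0 => // n _; rewrite expeS mul0e.
Qed.

End empty_process.

Unset Implicit Arguments.

Theorem corollary1p7 (R : realType) (lambda : R) (lambda_gt0 : 0 < lambda)
    (a : R) (a_gt0 : 0 < a) :
  exists v : point_process R,
    [/\ ulm v, supported_on (lattice a) v &
        forall w : point_process R, is_poisson lambda w ->
          mimics (1 / (2 * a)) v w].
Proof.
(* If there were no Poisson process, the last clause would be vacuous. *)
have [[w wP]|noP] := pselect (exists w : point_process R, is_poisson lambda w).
  exists (round_process a_gt0 w); split.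
  - exact: round_process_ulm wP.
  - exact: round_process_supported.
  - by move=> w' w'P; exact: round_process_mimics wP w'P.
exists (@empty_process R); split; first exact: empty_process_ulm.
  by move=> o j [].
by move=> w wP; exfalso; apply: noP; exists w.
Qed.
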